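(* Let $M \in \{0,1\}^{n \times n}$ be a binary matrix with twin-width $d$. Then $M$ can be preprocessed in time $\widetilde{\mathcal{O}}_d(n^2)$ so that afterwards, for an arbitrary column vector $v \in \mathbb{R}^n$, each of the products $Mv$ and $v^\intercal M$ can be computed in time $\widetilde{\mathcal{O}}_d(n)$.
   Context: Running times are measured assuming unit-cost arithmetic operations on scalars. The notation $\widetilde{\mathcal{O}}_d(\cdot)$ hides factors polylogarithmic in $n$ and factors depending only on $d$. The preprocessing receives only the matrix $M$, with its rows and columns in arbitrary order; neither $d$ nor any ordering or merge sequence witnessing the twin-width is given. Definitions. A division of an $n\times n$ matrix $M$ is a pair $(\mathcal{R},\mathscr{C})$ of partitions of $[n]$ into contiguous non-empty intervals; the cell $(i,j)$ is the submatrix of $M$ with rows in the $i$-th interval of $\mathcal{R}$ and columns in the $j$-th interval of $\mathscr{C}$; a cell is constant if all its entries are equal. A row (resp. column) of the division is the set of cells sharing a given interval of $\mathcal{R}$ (resp. $\mathscr{C}$). A merge sequence of $M$ is a sequence of divisions $(\mathcal{R}_{2n-1},\mathscr{C}_{2n-1}),\dots,(\mathcal{R}_1,\mathscr{C}_1)$ where $\mathcal{R}_{2n-1}=\mathscr{C}_{2n-1}$ is the partition into singletons, $\mathcal{R}_1=\mathscr{C}_1=\{[n]\}$, and each division is obtained from the previous one by merging two adjacent intervals of either the row partition or the column partition (not both). It is $d$-wide if in every division every row and every column contains at most $d$ non-constant cells. $M$ is $d$-twin-ordered if it admits a $d$-wide merge sequence. The twin-width of $M$ is the smallest $d$ such that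 the rows and columns of $M$ can be (independently) permuted to yield a $d$-twin-ordered matrix. *)

(* Defs.v *)
From HB Require Import structures.
From mathcomp Require Import all_boot all_order all_algebra all_fingroup.
From mathcomp Require Import reals.
Set Implicit Arguments. Unset Strict Implicit. Unset Printing Implicit Defensive.
Import Order.TTheory GRing.Theory Num.Theory.
Local Open Scope ring_scope.

Definition interval_set n (A : {set 'I_n}) : bool :=
  [forall x : 'I_n, forall y : 'I_n, forall z : 'I_n,
     [&& x \in A, z \in A & (x <= y <= z)%N] ==> (y \in A)].

Definition interval_partition n (P : {set {set 'I_n}}) : bool :=
  partition P [set: 'I_n] && [forall A in P, interval_set A].

(* A division: (row partition, column partition). *)
Definition division n := ({set {set 'I_n}} * {set {set 'I_n}})%type.

Definition is_division n (D : division n) : bool :=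
  interval_partition D.1 && interval_partition D.2.

Definition adjacent n (A B : {set 'I_n}) : bool :=
  [exists a in A, exists b in B, (b : nat) == a.+1].

Definition merge_of n (P P' : {set {set 'I_n}}) : Prop :=
  exists A B, [/\ A \in P, B \in P, adjacent A B &
                  P' = ((P :\ A) :\ B) :|: [set A :|: B]].

Definition merge_step n (D D' : division n) : Prop :=
  (merge_of D.1 D'.1 /\ D'.2 = D.2) \/ (merge_of D.2 D'.2 /\ D'.1 = D.1).

Definition finest_part n : {set {set 'I_n}} := [set [set i] | i : 'I_n].
Definition coarsest_part n : {set {set 'I_n}} := [set [set: 'I_n]].

Definition const_cell n (M : 'M[bool]_n) (R C : {set 'I_n}) : bool :=
  [exists b : bool, [forall i in R, forall j in C, M i j == b]].

Definition d_wide_division n (M : 'M[bool]_n) (d : nat) (D : division n) : bool :=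
  [forall R in D.1, #|[set C in D.2 | ~~ const_cell M R C]| <= d]%N &&
  [forall C in D.2, #|[set R in D.1 | ~~ const_cell M R C]| <= d]%N.

(* d-wide merge sequence: divisions S 0, ..., S (2n-2) (the paper's
   (R_{2n-1},C_{2n-1}), ..., (R_1,C_1)). *)
Definition d_twin_ordered n (M : 'M[bool]_n) (d : nat) : Prop :=
  exists S : nat -> division n,
    [/\ S 0%N = (finest_part n, finest_part n),
        S (2 * n - 2)%N = (coarsest_part n, coarsest_part n),
        (forall k, (k <= 2 * n - 2)%N -> is_division (S k) /\ d_wide_division M d (S k)) &
        (forall k, (k < 2 * n - 2)%N -> merge_step (S k) (S k.+1))].

Definition permute_mx n (M : 'M[bool]_n) (s t : 'S_n) : 'M[bool]_n :=
  \matrix_(i, j) M (s i) (t j).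

Definition twin_width_le n (M : 'M[bool]_n) (d : nat) : Prop :=
  exists s t : 'S_n, d_twin_ordered (permute_mx M s t) d.

Definition twin_width n (M : 'M[bool]_n) (d : nat) : Prop :=
  twin_width_le M d /\ forall d', (d' < d)%N -> ~ twin_width_le M d'.

(* Machine model: a RAM with unit-cost operations.                     *)
(*  - a nat memory (addresses / integers): +, truncated -, <, direct   *)
(*    and indirect load/store, conditional jump;                       *)
(*  - a real memory, indirectly addressed through nat cells, with      *)
(*    unit-cost +, -, *, comparison, constants 0 and 1.                *)
(* No conversion from reals to integers (no floor).                    *)

Inductive instr : Type :=
| NConst (a : nat) (k : nat)
| NAdd (a b c : nat)
| NSub (a b c : nat)
| NLt (a b c : nat)
| NLoad (a b : nat)
| NStore (a b : nat)
| Jz (a : nat) (l : nat)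
| RConst (a : nat) (b : bool)
| RMov (a b : nat)
| RAdd (a b c : nat)
| RSub (a b c : nat)
| RMul (a b c : nat)
| RLe (a b c : nat)
| Halt.

Definition program := seq instr.

Record cfg (R : realType) := Cfg { pc : nat; nmem : nat -> nat; rmem : nat -> R }.

Definition upd {T : Type} (f : nat -> T) (a : nat) (v : T) : nat -> T :=
  fun x => if x == a then v else f x.

Definition step (R : realType) (p : program) (c : cfg R) : option (cfg R) :=
  let N := nmem c in let Rm := rmem c in let nx := (pc c).+1 in
  if (size p <= pc c)%N then None else
  match nth Halt p (pc c) with
  | NConst a k => Some (Cfg nx (upd N a k) Rm)
  | NAdd a b d => Some (Cfg nx (upd N a (N b + N d)%N) Rm)
  | NSub a b d => Some (Cfg nx (upd N a (N b - N d)%N) Rm)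
  | NLt a b d => Some (Cfg nx (upd N a (N b < N d)%N) Rm)
  | NLoad a b => Some (Cfg nx (upd N a (N (N b))) Rm)
  | NStore a b => Some (Cfg nx (upd N (N a) (N b)) Rm)
  | Jz a l => Some (Cfg (if N a == 0%N then l else nx) N Rm)
  | RConst a b => Some (Cfg nx N (upd Rm (N a) (b%:R)))
  | RMov a b => Some (Cfg nx N (upd Rm (N a) (Rm (N b))))
  | RAdd a b d => Some (Cfg nx N (upd Rm (N a) (Rm (N b) + Rm (N d))))
  | RSub a b d => Some (Cfg nx N (upd Rm (N a) (Rm (N b) - Rm (N d))))
  | RMul a b d => Some (Cfg nx N (upd Rm (N a) (Rm (N b) * Rm (N d))))
  | RLe a b d => Some (Cfg nx (upd N a (Rm (N b) <= Rm (N d))) Rm)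
  | Halt => None
  end.

Fixpoint exec (R : realType) (p : program) (c : cfg R) (k : nat) : option (cfg R) :=
  match k with
  | 0%N => Some c
  | k'.+1 => match step p c with Some c' => exec p c' k' | None => None end
  end.

Definition halts_within (R : realType) (p : program) (c : cfg R) (T : nat) (c' : cfg R) : Prop :=
  exists k, (k <= T)%N /\ exec p c k = Some c' /\ step p c' = None.

(* Input encoding of M: N[0] = n, N[1 + i*n + j] = M i j; all else 0. *)
Definition input_cfg (R : realType) n (M : 'M[bool]_n) : cfg R :=
  Cfg 0 (fun a => if a == 0%N then n else
                  match insub (a.-1 %/ n)%N, insub (a.-1 %% n)%N with
                  | Some i, Some j => nat_of_bool (M i j)
                  | _, _ => 0%N
                  end)
      (fun _ => 0).

Definition query_cfg (R : realType) n (S : cfg R) (v : 'cV[R]_n) : cfg R :=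
  Cfg 0 (nmem S) (fun a => match insub a with Some i => v i 0 | None => rmem S a end).

Definition real_mx (R : realType) n (M : 'M[bool]_n) : 'M[R]_n :=
  map_mx (fun b : bool => (b%:R : R)) M.

Definition lg (n : nat) : nat := (trunc_log 2 n).+1.

(* Main.v *)
Require Import Defs.
From HB Require Import structures.
From mathcomp Require Import all_boot all_order all_algebra all_fingroup.
From mathcomp Require Import reals.
From mathcomp Require Import zify ring.
Set Implicit Arguments. Unset Strict Implicit. Unset Printing Implicit Defensive.
Import Order.TTheory GRing.Theory Num.Theory.

(** Let A be a set of rows that are pairwise distinct on a set B of columns.
    At the first merge of two columns of B, every row part meets A in at most
    2^d rows, so the two merged columns differ on at most d 2^d rows of A;
    deleting these rows and one of the columns and inducting gives
    |A| = O_d(|B|).  If the rows of A have pairwise Hamming distance at least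
    delta, then O((n / delta) log n) greedily chosen columns separate them, so
    |A| = O_d((n / delta) log n).  Hence, if every row is attached to a nearest
    earlier row, the distances sum to O_d(n log^2 n).  A row is then its parent
    plus a sparse correction: M v is computed by a straight-line tape of that
    length, and v^T M by the transposed tape run backwards.

    The distances of row i to all earlier rows come out of n additions of
    unbounded integers: with X = 2^w > n and A_k = sum_(j < i) M_jk X^j, the
    sum over k of A_k (if M_ik = 0) or sum_(j < i) X^j - A_k (if M_ik = 1) is
    sum_(j < i) dist(i, j) X^j, whose digits are read off by repeated doubling
    and comparison with X^i. *)

(** * Neighbourhood complexity and packing *)

Definition separated n (M : 'M[bool]_n) (A B : {set 'I_n}) : Prop :=
  {in A &, forall r r', {in B, forall c, M r c = M r' c} -> r = r'}.

Lemma card_separated n (M : 'M[bool]_n) (A B : {set 'I_n}) :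
  separated M A B -> #|A| <= 2 ^ #|B|.
Proof.
move=> sAB; pose g r := [set c in B | M r c].
have g_inj : {in A &, injective g}.
  move=> r r' rA r'A /setP e; apply: sAB => // c cB.
  by have := e c; rewrite !inE cB.
rewrite -card_powerset -(card_in_imset g_inj); apply/subset_leq_card/subsetP.
by move=> _ /imsetP[r _ ->]; rewrite inE; apply/subsetP => c; rewrite inE => /andP[].
Qed.

Lemma mem_part n (P : {set {set 'I_n}}) (i : 'I_n) :
  interval_partition P -> exists2 A, A \in P & i \in A.
Proof.
move=> /andP[/and3P[/eqP cov _ _] _].
have : i \in cover P by rewrite cov inE.
by move=> /bigcupP[A AP iA]; exists A.
Qed.

(* Just before the first merge of two columns of B, every row part meets A in
   at most 2^d rows, and after it at most d row parts see both columns in a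
   non-constant cell. *)
Lemma near_twin_columns n (M : 'M[bool]_n) d (A B : {set 'I_n}) :
  d_twin_ordered M d -> 1 < #|B| -> separated M A B ->
  exists c c', [/\ c \in B, c' \in B, c != c' &
    #|[set r in A | M r c != M r c']| <= d * 2 ^ d].
Proof.
move=> [S [S0 Sl Sdiv Sstep]] B_gt1 sAB.
pose Q t := [exists c in B, exists c' in B, (c != c') &&
   [exists C in (S t).2, (c \in C) && (c' \in C)]].
have Ql : Q (2 * n - 2).
  move: B_gt1 => /card_gt1P[c [c' [cB c'B cc']]].
  apply/existsP; exists c; rewrite cB /=; apply/existsP; exists c'.
  rewrite c'B cc' /=; apply/existsP; exists [set: 'I_n].
  by rewrite Sl !inE eqxx.
case: (ex_minnP (ex_intro (fun t => is_true (Q t)) _ Ql)) => t Qt tmin.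
have tl : t <= 2 * n - 2 by apply: tmin.
move: (Qt) => /existsP[c /andP[cB /existsP[c' /and3P[c'B cc']]]].
move=> /existsP[C /and3P[CS cC c'C]].
case: t => [|t] in Qt tmin tl CS *.
  move: CS; rewrite S0 => /imsetP[x _ Cx].
  by move: cC c'C cc'; rewrite Cx !inE => /eqP-> /eqP->; rewrite eqxx.
have nQt : ~~ Q t by apply/negP => /tmin; rewrite ltnn.
have rows : (S t.+1).1 = (S t).1.
  case: (Sstep t tl) => [[_ e]|[_ e]] //.
  by move/negP: nQt; case; move: Qt; rewrite /Q e.
have [/andP[pr pc] /andP[_ wide']] := Sdiv t.+1 tl.
have [/andP[_ pc0] /andP[wide _]] := Sdiv t (ltnW tl).
exists c, c'; split => //.
pose NR := [set R in (S t.+1).1 | ~~ const_cell M R C].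
have NRd : #|NR| <= d by move/forall_inP: wide' => /(_ C CS).
have sub : [set r in A | M r c != M r c'] \subset \bigcup_(R in NR) (A :&: R).
  apply/subsetP => r; rewrite inE => /andP[rA ne].
  have [R RS rR] := mem_part r pr.
  apply/bigcupP; exists R; last by rewrite inE rA.
  rewrite inE RS /=; apply/negP => /existsP[b /forall_inP/(_ r rR)/forall_inP h].
  by move: ne; rewrite (eqP (h c cC)) (eqP (h c' c'C)) eqxx.
apply: (leq_trans (subset_leq_card sub)).
have le1 R : R \in NR -> #|A :&: R| <= 2 ^ d.
  rewrite inE rows => /andP[RS _].
  pose NC := [set D in (S t).2 | ~~ const_cell M R D].
  have NCd : #|NC| <= d by move/forall_inP: wide => /(_ R RS).
  pose g r := [set D in NC | [exists x in B, (x \in D) && M r x]].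
  have g_inj : {in A :&: R &, injective g}.
    move=> r r'; rewrite !inE => /andP[rA rR] /andP[r'A r'R] /setP e.
    apply: sAB => // x xB; have [D DS xD] := mem_part x pc0.
    case cst : (const_cell M R D).
      move: cst => /existsP[b /forall_inP h].
      by rewrite (eqP (forall_inP (h r rR) x xD)) (eqP (forall_inP (h r' r'R) x xD)).
    have hE u : [exists y in B, (y \in D) && M u y] = M u x.
      apply/existsP/idP => [[y /and3P[yB yD uy]]|ux]; last by exists x; rewrite xB xD.
      have -> // : x = y.
      apply/eqP/negPn/negP => xy; move/negP: nQt; apply.
      apply/existsP; exists x; rewrite xB; apply/existsP; exists y; rewrite yB xy /=.
      by apply/existsP; exists D; rewrite DS xD yD.
    by have := e D; rewrite !inE DS cst /= !hE.
  rewrite -(card_in_imset g_inj).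
  apply: leq_trans (_ : #|powerset NC| <= _); last by rewrite card_powerset leq_exp2l.
  apply/subset_leq_card/subsetP => _ /imsetP[r _ ->].
  by rewrite inE; apply/subsetP => D; rewrite inE => /andP[].
apply: leq_trans (_ : \sum_(R in NR) #|A :&: R| <= _).
  elim/big_rec2: _ => [|R x y _ h]; first by rewrite cards0.
  by apply: leq_trans (leq_card_setU _ _) _; rewrite leq_add2l.
apply: leq_trans (_ : \sum_(R in NR) 2 ^ d <= _).
  by apply: leq_sum => R /le1.
by rewrite sum_nat_const leq_mul2r NRd orbT.
Qed.

Lemma separated_bound n (M : 'M[bool]_n) d (A B : {set 'I_n}) :
  d_twin_ordered M d -> separated M A B -> #|A| <= d * 2 ^ d * #|B| + 2.
Proof.
move=> Md; have [k] := ubnP #|B|; elim: k => // k IH in A B *.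
rewrite ltnS => Bk sAB; case: (leqP #|B| 1) => [B1|B_gt1].
  apply: leq_trans (card_separated sAB) _.
  apply: leq_trans (_ : 2 ^ 1 <= _); first by rewrite leq_exp2l.
  by rewrite leq_addl.
have [c [c' [cB c'B cc' le]]] := near_twin_columns Md B_gt1 sAB.
pose E := [set r in A | M r c != M r c'].
have cardB : #|B| = #|B :\ c'|.+1 by rewrite (cardsD1 c' B) c'B.
have sep : separated M (A :\: E) (B :\ c').
  move=> r r'; rewrite !inE => /andP[rE rA] /andP[r'E r'A] h.
  move: rE r'E; rewrite rA r'A /= !negbK => /eqP e /eqP e'.
  apply: sAB => // x xB; case: (eqVneq x c') => [->|xc].
    by rewrite -e -e'; apply: h; rewrite !inE cc' cB.
  by apply: h; rewrite !inE xc.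
have := IH _ _ _ sep; rewrite -ltnS -cardB ltnS => /(_ Bk) h.
have cardA : #|A| <= #|E| + #|A :\: E|.
  by rewrite -(cardsID E A) leq_add2r; apply/subset_leq_card/subsetIr.
apply: leq_trans cardA _; rewrite cardB.
by rewrite mulnS -addnA; apply: leq_add.
Qed.

Lemma separated_bound_tww n (M : 'M[bool]_n) d (A B : {set 'I_n}) :
  twin_width_le M d -> separated M A B -> #|A| <= d * 2 ^ d * #|B| + 2.
Proof.
move=> [s [t Md]] sAB.
rewrite -(card_imset A (@perm_inj _ (s^-1)%g)) -(card_imset B (@perm_inj _ (t^-1)%g)).
apply: separated_bound Md _ => _ _ /imsetP[r rA ->] /imsetP[r' r'A ->] h.
congr (fun_of_perm _ _); apply: sAB => // c cB.
by have := h _ (imset_f _ cB); rewrite !mxE !permKV.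
Qed.

Definition hamming n (M : 'M[bool]_n) (r r' : 'I_n) : nat :=
  \sum_c (M r c != M r' c).

Definition unresolved n (M : 'M[bool]_n) (A B : {set 'I_n}) : {set 'I_n * 'I_n} :=
  [set p | [&& p.1 \in A, p.2 \in A, p.1 != p.2 &
               [forall c in B, M p.1 c == M p.2 c]]].

Lemma resolving_column n (M : 'M[bool]_n) (A B : {set 'I_n}) delta :
  0 < n -> delta <= n ->
  {in A &, forall r r', r != r' -> delta <= hamming M r r'} ->
  exists c, #|unresolved M A (c |: B)| * n <= #|unresolved M A B| * (n - delta).
Proof.
move=> n0 dn far; set U := unresolved M A B.
have UE c : #|unresolved M A (c |: B)| = \sum_(p in U) (M p.1 c == M p.2 c).
  rewrite -sum1_card [RHS]big_mkcond /= big_mkcond /=; apply: eq_bigr => p _.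
  rewrite !inE.
  have -> : [forall x in c |: B, M p.1 x == M p.2 x] =
     (M p.1 c == M p.2 c) && [forall x in B, M p.1 x == M p.2 x].
    apply/forall_inP/andP => [h|[h1 /forall_inP h2] x].
      by split; [apply: h; rewrite !inE eqxx|apply/forall_inP => x xB; apply: h; rewrite !inE xB orbT].
    by rewrite !inE => /orP[/eqP->|/h2].
  by case: (p.1 \in A); case: (p.2 \in A); case: (p.1 != p.2);
     case: (M p.1 c == M p.2 c); case: [forall x in B, _].
have sumU : \sum_c #|unresolved M A (c |: B)| <= #|U| * (n - delta).
  under eq_bigr do rewrite UE.
  rewrite exchange_big /= -sum_nat_const; apply: leq_sum => p.
  rewrite !inE => /and4P[p1 p2 p12 _].
  have := far _ _ p1 p2 p12; rewrite /hamming.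
  have : \sum_c (M p.1 c != M p.2 c) + \sum_c (M p.1 c == M p.2 c) = n.
    rewrite -big_split /= -[RHS](card_ord n) -sum1_card.
    by apply: eq_bigr => c _; case: (_ == _).
  move: (\sum_c (M p.1 c != M p.2 c)) (\sum_c (M p.1 c == M p.2 c)) => x y.
  by clear -dn; lia.
apply/existsP; rewrite -[X in is_true X]negbK negb_exists; apply/negP => /forallP h.
have : \sum_(c : 'I_n) (#|U| * (n - delta)).+1 <= (\sum_c #|unresolved M A (c |: B)|) * n.
  by rewrite big_distrl /=; apply: leq_sum => c _; have := h c; rewrite -ltnNge.
rewrite sum_nat_const card_ord mulnC leq_pmul2r // leqNgt.
by rewrite ltnS sumU.
Qed.

Lemma greedy_columns n (M : 'M[bool]_n) (A : {set 'I_n}) delta s :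
  0 < n -> delta <= n ->
  {in A &, forall r r', r != r' -> delta <= hamming M r r'} ->
  exists2 B : {set 'I_n}, #|B| <= s &
    #|unresolved M A B| * n ^ s <= #|A| ^ 2 * (n - delta) ^ s.
Proof.
move=> n0 dn far; elim: s => [|s [B Bs IH]].
  exists set0; rewrite ?cards0 // !expn0 !muln1 -mulnn -cardsX.
  by apply/subset_leq_card/subsetP => p; rewrite !inE => /and4P[-> ->].
have [c hc] := resolving_column B n0 dn far.
exists (c |: B).
  by apply: leq_trans (leq_card_setU _ _) _; rewrite cards1 add1n.
rewrite (expnS n) (expnS (n - delta)) mulnA.
apply: leq_trans (leq_mul hc (leqnn _)) _.
by rewrite mulnAC [X in _ <= X]mulnCA mulnC leq_mul2l IH orbT.
Qed.

Lemma bernoulli_half n delta s :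
  0 < s -> n <= s * delta -> delta <= n -> 2 * (n - delta) ^ s <= n ^ s.
Proof.
move=> s0 ns dn; have e : n = (n - delta) + delta by rewrite subnK.
set m := n - delta in e *.
have bern k : m ^ k.+1 + k.+1 * delta * m ^ k <= (m + delta) ^ k.+1.
  elim: k => [|k IH]; first by rewrite !expn1 expn0 mul1n muln1.
  rewrite [X in _ <= X]expnS; apply: leq_trans (leq_mul (leqnn (m + delta)) IH).
  rewrite !expnS; set x := m ^ k; clear; nia.
case: s s0 ns => // s _ ns.
rewrite [X in _ <= X ^ _]e; apply: leq_trans (bern s).
rewrite mul2n -addnn leq_add2l expnS leq_mul2r.
by rewrite (leq_trans _ ns) ?orbT // leq_subr.
Qed.

Lemma ltn_lg n : n < 2 ^ lg n.
Proof. by case: n => // n; rewrite /lg trunc_log_ltn. Qed.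

Lemma packing_bound n (M : 'M[bool]_n) d (A : {set 'I_n}) delta :
  twin_width_le M d -> 0 < delta <= n ->
  {in A &, forall r r', r != r' -> delta <= hamming M r r'} ->
  #|A| <= d * 2 ^ d * ((n %/ delta).+1 * (2 * lg n)) + 2.
Proof.
move=> Md /andP[d0 dn] far; have n0 := leq_trans d0 dn.
set s := (n %/ delta).+1; set q := 2 * lg n.
have q0 : 0 < q by rewrite /q /lg; lia.
have [B Bs h] := greedy_columns (s * q) n0 dn far.
apply: leq_trans (separated_bound_tww (B := B) Md _) _; last first.
  by rewrite leq_add2r leq_mul2l Bs orbT.
suff U0 : #|unresolved M A B| == 0.
  move=> r r' rA r'A e; apply/eqP/negPn/negP => rr'.
  move: U0; rewrite cards_eq0 => /eqP/setP/(_ (r, r')); rewrite !inE rA r'A rr' /=.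
  by move=> /negP; apply; apply/forall_inP => c cB; apply/eqP/e.
have half : 2 * (n - delta) ^ s <= n ^ s.
  by apply: bernoulli_half => //; rewrite ltnW // ltn_ceil.
case: (ltngtP delta n) dn => // [dn _|e _]; last first.
  move: h; rewrite e subnn exp0n ?muln0 ?muln_gt0 ?q0 // leqn0 muln_eq0.
  by rewrite expn_eq0 => /orP[//|/andP[/eqP n00 _]]; rewrite n00 in n0.
have pos : 0 < (n - delta) ^ (s * q) by rewrite expn_gt0 subn_gt0 dn.
have : #|unresolved M A B| * (2 ^ q) <= #|A| ^ 2.
  rewrite -(leq_pmul2r pos); apply: leq_trans h.
  rewrite -mulnA leq_mul2l; apply/orP; right.
  by rewrite (expnM (n - delta)) (expnM n) -expnMn leq_exp2r.
case: (posnP #|unresolved M A B|) => [->//|u0] h'.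
have : #|A| ^ 2 < 2 ^ q.
  rewrite /q mulnC expnM ltn_exp2r //.
  by apply: leq_ltn_trans (ltn_lg n); rewrite -[X in _ <= X]card_ord max_card.
rewrite ltnNge (leq_trans _ h') // -[X in X <= _]mul1n leq_mul2r; lia.
Qed.

Lemma sum_dyadic_le n (x : nat) : x <= n ->
  x <= \sum_(b < lg n) (2 ^ b <= x) * 2 ^ b.+1.
Proof.
case: x => // x xn.
have lt : trunc_log 2 x.+1 < lg n by rewrite /lg ltnS leq_trunc_log.
rewrite (bigD1 (Ordinal lt)) //= trunc_logP // mul1n.
by apply: leq_trans (leq_addr _ _); rewrite ltnW // trunc_log_ltn.
Qed.

Lemma sum_greedy_distances n (M : 'M[bool]_n) d (dist : 'I_n -> nat) :
  twin_width_le M d -> (forall i, dist i <= n) ->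
  (forall i j : 'I_n, j < i -> dist i <= hamming M i j) ->
  \sum_i dist i <= (d * 2 ^ d * 8 + 4) * n * lg n ^ 2.
Proof.
move=> Md distn far.
pose A b := [set i : 'I_n | 2 ^ b <= dist i].
have symh i j : hamming M i j = hamming M j i.
  by apply: eq_bigr => c _; rewrite eq_sym.
have farA b : {in A b &, forall r r', r != r' -> 2 ^ b <= hamming M r r'}.
  move=> r r'; rewrite !inE => hr hr' ne.
  case: (ltngtP r r') => [lt|lt|/val_inj e]; last by rewrite e eqxx in ne.
    by rewrite symh; apply: leq_trans hr' (far _ _ lt).
  by apply: leq_trans hr (far _ _ lt).
apply: leq_trans (_ : \sum_(b < lg n) #|A b| * 2 ^ b.+1 <= _).
  apply: leq_trans (_ : \sum_i \sum_(b < lg n) (2 ^ b <= dist i) * 2 ^ b.+1 <= _).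
    by apply: leq_sum => i _; apply: sum_dyadic_le.
  rewrite exchange_big /=; apply: leq_sum => b _.
  rewrite -big_distrl /= leq_mul2r; apply/orP; right.
  by rewrite -sum1_card [X in _ <= X]big_mkcond; apply: leq_sum => i _; rewrite inE; case: (2 ^ b <= dist i).
have termb b : #|A b| * 2 ^ b.+1 <= (d * 2 ^ d * 8 + 4) * n * lg n.
  case: (leqP (2 ^ b) n) => bn; last first.
    have -> : A b = set0 by apply/setP => i; rewrite !inE leqNgt (leq_ltn_trans (distn i) bn).
    by rewrite cards0.
  have b0 : 0 < 2 ^ b <= n by rewrite expn_gt0.
  have := packing_bound Md b0 (@farA b).
  have : (n %/ 2 ^ b) * 2 ^ b <= n by exact: leq_trunc_div.
  have : 0 < lg n by [].
  rewrite expnS; move: (d * 2 ^ d) (2 ^ b) bn (lg n) #|A b| => K z zn l a l0.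
  move: (n %/ z) => y yz aK.
  apply: leq_trans (leq_mul aK (leqnn _)) _.
  have h1 : y.+1 * z <= 2 * n by rewrite mulSn; clear -yz zn; lia.
  have h2 : K * (l * (y.+1 * z)) <= K * (l * (2 * n)) by rewrite !leq_mul2l h1 !orbT.
  have h3 : z <= n * l by apply: leq_trans zn _; rewrite leq_pmulr.
  have -> : (K * (y.+1 * (2 * l)) + 2) * (2 * z) = 4 * (K * (l * (y.+1 * z))) + 4 * z.
    by clear; move: (y.+1) => u; nia.
  have -> : (K * 8 + 4) * n * l = 4 * (K * (l * (2 * n))) + 4 * (n * l) by clear; nia.
  by clear -h2 h3; lia.
apply: leq_trans (_ : \sum_(b < lg n) (d * 2 ^ d * 8 + 4) * n * lg n <= _).
  by apply: leq_sum => b _; apply: termb.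
by rewrite sum_nat_const card_ord mulnC -mulnA mulnn.
Qed.

(** * Structured programs on the RAM *)

Section Machine.
Variable R : realType.

Definition memory : Type := (nat -> nat) * (nat -> R).

Definition straight (i : instr) : bool :=
  match i with Jz _ _ | Halt => false | _ => true end.

Definition exec_instr (s : memory) (i : instr) : memory :=
  let: (N, Rm) := s in
  match i with
  | NConst a k => (upd N a k, Rm)
  | NAdd a b d => (upd N a (N b + N d), Rm)
  | NSub a b d => (upd N a (N b - N d), Rm)
  | NLt a b d => (upd N a (N b < N d), Rm)
  | NLoad a b => (upd N a (N (N b)), Rm)
  | NStore a b => (upd N (N a) (N b), Rm)
  | RConst a b => (N, upd Rm (N a) (b%:R)%R)
  | RMov a b => (N, upd Rm (N a) (Rm (N b)))
  | RAdd a b d => (N, upd Rm (N a) (Rm (N b) + Rm (N d))%R)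
  | RSub a b d => (N, upd Rm (N a) (Rm (N b) - Rm (N d))%R)
  | RMul a b d => (N, upd Rm (N a) (Rm (N b) * Rm (N d))%R)
  | RLe a b d => (upd N a (Rm (N b) <= Rm (N d))%R, Rm)
  | Jz _ _ | Halt => s
  end.

(* [LLoop a c] is "while cell a is nonzero, decrement it and run c"; cell 1 is
   scratch for the loop control. *)
Inductive lcmd := LBlock of seq instr | LSeq of lcmd & lcmd | LLoop of nat & lcmd.

Fixpoint lsize (c : lcmd) : nat :=
  match c with
  | LBlock l => size l
  | LSeq c1 c2 => lsize c1 + lsize c2
  | LLoop _ c => lsize c + 5
  end.

Fixpoint compile (off : nat) (c : lcmd) : seq instr :=
  match c with
  | LBlock l => l
  | LSeq c1 c2 => compile off c1 ++ compile (off + lsize c1) c2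
  | LLoop a c => [:: Jz a (off + (lsize c + 5)); NConst 1 1; NSub a a 1] ++
                 compile (off + 3) c ++ [:: NConst 1 0; Jz 1 off]
  end.

Lemma size_compile off c : size (compile off c) = lsize c.
Proof.
elim: c off => //= [c1 IH1 c2 IH2|a c IH] off; first by rewrite size_cat IH1 IH2.
by rewrite size_cat IH /= addn2 addnS !addnS addn0.
Qed.

Inductive ev : lcmd -> memory -> nat -> memory -> Prop :=
| ev_block l s : all straight l -> ev (LBlock l) s (size l) (foldl exec_instr s l)
| ev_seq c1 c2 s t1 s1 t2 s2 : ev c1 s t1 s1 -> ev c2 s1 t2 s2 ->
    ev (LSeq c1 c2) s (t1 + t2) s2
| ev_loop0 a c s : s.1 a = 0 -> ev (LLoop a c) s 1 s
| ev_loopS a c s k t s1 t' s2 : a != 1 -> s.1 a = k.+1 ->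
    ev c (upd (upd s.1 1 1) a k, s.2) t s1 ->
    ev (LLoop a c) (upd s1.1 1 0, s1.2) t' s2 ->
    ev (LLoop a c) s (5 + t + t') s2.

Lemma exec_add (p : program) (c : cfg R) k1 k2 :
  exec p c (k1 + k2) = obind (fun c' => exec p c' k2) (exec p c k1).
Proof. by elim: k1 c => //= k1 IH c; case: (step p c). Qed.

Lemma exec1 (p : program) (c : cfg R) : exec p c 1 = step p c.
Proof. by rewrite /=; case: (step p c). Qed.

Lemma step_straight (p1 p2 : program) i (s : memory) : straight i ->
  step (p1 ++ i :: p2) (Cfg (size p1) s.1 s.2) =
  Some (Cfg (size p1).+1 (exec_instr s i).1 (exec_instr s i).2).
Proof.
case: s => N Rm; rewrite /step /= size_cat /= leqNgt -[X in X < _]addn0 ltn_add2l /=.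
by rewrite nth_cat ltnn subnn /=; case: i.
Qed.

Lemma step_jz (p1 p2 : program) a l (s : memory) :
  step (p1 ++ Jz a l :: p2) (Cfg (size p1) s.1 s.2) =
  Some (Cfg (if s.1 a == 0 then l else (size p1).+1) s.1 s.2).
Proof.
rewrite /step /= size_cat /= leqNgt -[X in X < _]addn0 ltn_add2l /=.
by rewrite nth_cat ltnn subnn.
Qed.

Lemma exec_block (p1 l p2 : program) (s : memory) : all straight l ->
  exec (p1 ++ l ++ p2) (Cfg (size p1) s.1 s.2) (size l) =
  Some (Cfg (size p1 + size l) (foldl exec_instr s l).1 (foldl exec_instr s l).2).
Proof.
elim: l p1 s => [|i l IH] p1 s /=; first by rewrite addn0.
move=> /andP[si sl]; rewrite step_straight //.
by rewrite -cat_rcons -[_.+1](size_rcons p1 i) IH // size_rcons addSnnS.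
Qed.

Lemma exec_compile c (s s' : memory) t : ev c s t s' -> forall p1 p2,
  exec (p1 ++ compile (size p1) c ++ p2) (Cfg (size p1) s.1 s.2) t =
  Some (Cfg (size p1 + lsize c) s'.1 s'.2).
Proof.
elim=> {c s s' t}.
- by move=> l s sl p1 p2; apply: exec_block.
- move=> c1 c2 s t1 s1 t2 s2 _ IH1 _ IH2 p1 p2 /=.
  rewrite exec_add -catA IH1 /= catA.
  have e : size (p1 ++ compile (size p1) c1) = size p1 + lsize c1.
    by rewrite size_cat size_compile.
  by rewrite -e IH2 e addnA.
- by move=> a c s s0 p1 p2; rewrite /exec [compile _ _]/= step_jz s0.
- move=> a c s k t s1 t' s2 a1 sk _ IH _ IHl p1 p2.
  set p := p1 ++ _ ++ _.
  have pE : p = (p1 ++ [:: Jz a (size p1 + (lsize c + 5)); NConst 1 1; NSub a a 1]) ++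
      compile (size p1 + 3) c ++ [:: NConst 1 0; Jz 1 (size p1)] ++ p2.
    by rewrite /p -!catA /= -?catA.
  have -> : 5 + t + t' = 3 + (t + (2 + t')) by lia.
  rewrite exec_add.
  have -> : exec p (Cfg (size p1) s.1 s.2) 3 =
     Some (Cfg (size p1 + 3) (upd (upd s.1 1 1) a k) s.2).
    have := @step_jz p1 (behead (compile (size p1) (LLoop a c)) ++ p2) a
      (size p1 + (lsize c + 5)) s.
    have := @exec_block (rcons p1 (Jz a (size p1 + (lsize c + 5))))
      [:: NConst 1 1; NSub a a 1]
      (compile (size p1 + 3) c ++ [:: NConst 1 0; Jz 1 (size p1)] ++ p2) s isT.
    rewrite cat_rcons size_rcons sk (exec_add _ _ 1 2) exec1.
    have -> : p1 ++ Jz a (size p1 + (lsize c + 5)) :: behead (compile (size p1) (LLoop a c)) ++ p2 = p by [].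
    rewrite [_ ++ _ :: _ in X in X -> _](_ : _ = p); last by rewrite pE -catA.
    move=> h -> /=; move: h => /= ->; case: s sk {IH} => N Rm /= sk.
    by rewrite /upd eqxx (negbTE a1) sk subn1 addSnnS.
  rewrite [obind _ _]/= exec_add.
  have e3 : size (p1 ++ [:: Jz a (size p1 + (lsize c + 5)); NConst 1 1; NSub a a 1]) =
     size p1 + 3 by rewrite size_cat.
  have IH' := IH (p1 ++ [:: Jz a (size p1 + (lsize c + 5)); NConst 1 1; NSub a a 1])
    ([:: NConst 1 0; Jz 1 (size p1)] ++ p2).
  rewrite e3 -pE [(_, _).1]/= [(_, _).2]/= in IH'.
  rewrite IH' /obind /oapp exec_add.
  have -> : exec p (Cfg (size p1 + 3 + lsize c) s1.1 s1.2) 2 =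
     Some (Cfg (size p1) (upd s1.1 1 0) s1.2).
    set q := (p1 ++ [:: Jz a (size p1 + (lsize c + 5)); NConst 1 1; NSub a a 1]) ++
      compile (size p1 + 3) c.
    have e4 : size p1 + 3 + lsize c = size q by rewrite !size_cat size_compile.
    have e5 : p = q ++ [:: NConst 1 0] ++ [:: Jz 1 (size p1)] ++ p2.
      by rewrite pE /q -!catA.
    rewrite (exec_add _ _ 1 1) e4 e5.
    rewrite (@exec_block q [:: NConst 1 0] _ s1 isT) /obind /oapp exec1 catA.
    have -> : size q + 1 = size (q ++ [:: NConst 1 0]) by rewrite size_cat.
    case: s1 {IH IHl IH'} => N Rm.
    by rewrite (@step_jz _ _ 1 _ (upd N 1 0, Rm)).
  by rewrite [obind _ _]/= /p IHl.
Qed.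

Lemma ev_halts c (s s' : memory) t T : ev c s t s' -> t <= T ->
  halts_within (compile 0 c) (Cfg 0 s.1 s.2) T (Cfg (lsize c) s'.1 s'.2).
Proof.
move=> h tT; exists t; split=> //; split.
  by have := exec_compile h [::] [::]; rewrite cats0.
by rewrite /step /= size_compile leqnn.
Qed.

End Machine.

(** * Registers and arrays *)

(* Registers are the nat cells below 32, of which 1 and 2 are scratch; entry i
   of array k < 8 is the nat cell [cell k i]. *)
Inductive hcmd :=
| HConst of nat & nat
| HAdd of nat & nat & nat
| HSub of nat & nat & nat
| HLt of nat & nat & nat
| HLoad (k r i : nat)
| HStore (k i r : nat)
| HRAdd of nat & nat & nat
| HRSub of nat & nat & nat
| HSeq of hcmd & hcmd
| HLoop of nat & hcmd.

Notation "c1 ;; c2" := (HSeq c1 c2) (at level 100, right associativity).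

Definition okr (r : nat) : bool := (r == 0) || (2 < r < 32).
Definition cell (k i : nat) : nat := 32 + 8 * i + k.

Fixpoint wregs (c : hcmd) : seq nat :=
  match c with
  | HConst r _ | HAdd r _ _ | HSub r _ _ | HLt r _ _ | HLoad _ r _ => [:: r]
  | HStore _ _ _ | HRAdd _ _ _ | HRSub _ _ _ => [::]
  | HSeq c1 c2 => wregs c1 ++ wregs c2
  | HLoop a c => a :: wregs c
  end.

Fixpoint warrs (c : hcmd) : seq nat :=
  match c with
  | HStore k _ _ => [:: k]
  | HSeq c1 c2 => warrs c1 ++ warrs c2
  | HLoop a c => warrs c
  | _ => [::]
  end.

Fixpoint wreal (c : hcmd) : bool :=
  match c with
  | HRAdd _ _ _ | HRSub _ _ _ => true
  | HSeq c1 c2 => wreal c1 || wreal c2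
  | HLoop a c => wreal c
  | _ => false
  end.

Fixpoint wf (c : hcmd) : bool :=
  match c with
  | HConst r _ => okr r
  | HAdd r a b | HSub r a b | HLt r a b | HRAdd r a b | HRSub r a b =>
      [&& okr r, okr a & okr b]
  | HLoad k r i => [&& k < 8, okr r & okr i]
  | HStore k i r => [&& k < 8, okr r & okr i]
  | HSeq c1 c2 => wf c1 && wf c2
  | HLoop a c => [&& okr a, a \notin wregs c & wf c]
  end.

Definition addr_code (k i : nat) : seq instr :=
  [:: NAdd 2 i i; NAdd 2 2 2; NAdd 2 2 2; NConst 1 (32 + k); NAdd 2 2 1].

Fixpoint tr (c : hcmd) : lcmd :=
  match c with
  | HConst r k => LBlock [:: NConst r k]
  | HAdd r a b => LBlock [:: NAdd r a b]
  | HSub r a b => LBlock [:: NSub r a b]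
  | HLt r a b => LBlock [:: NLt r a b]
  | HLoad k r i => LBlock (rcons (addr_code k i) (NLoad r 2))
  | HStore k i r => LBlock (rcons (addr_code k i) (NStore 2 r))
  | HRAdd r a b => LBlock [:: RAdd r a b]
  | HRSub r a b => LBlock [:: RSub r a b]
  | HSeq c1 c2 => LSeq (tr c1) (tr c2)
  | HLoop a c => LLoop a (tr c)
  end.

Section HighLevel.
Variable R : realType.

Record hst := Hst { reg : nat -> nat; arr : nat -> nat -> nat; rm : nat -> R }.

Definition setr (s : hst) (r v : nat) : hst := Hst (upd (reg s) r v) (arr s) (rm s).

Fixpoint countdown (f : nat -> hst -> hst) (m : nat) (s : hst) : hst :=
  if m is m'.+1 then countdown f m' (f m' s) else s.

Fixpoint countdown_cost (f : nat -> hst -> hst) (g : nat -> hst -> nat)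
    (m : nat) (s : hst) : nat :=
  if m is m'.+1 then 5 + g m' s + countdown_cost f g m' (f m' s) else 1.

Fixpoint den (c : hcmd) (s : hst) : hst :=
  match c with
  | HConst r k => setr s r k
  | HAdd r a b => setr s r (reg s a + reg s b)
  | HSub r a b => setr s r (reg s a - reg s b)
  | HLt r a b => setr s r (reg s a < reg s b)
  | HLoad k r i => setr s r (arr s k (reg s i))
  | HStore k i r =>
      Hst (reg s) (upd (arr s) k (upd (arr s k) (reg s i) (reg s r))) (rm s)
  | HRAdd r a b => Hst (reg s) (arr s)
      (upd (rm s) (reg s r) (rm s (reg s a) + rm s (reg s b))%R)
  | HRSub r a b => Hst (reg s) (arr s)
      (upd (rm s) (reg s r) (rm s (reg s a) - rm s (reg s b))%R)
  | HSeq c1 c2 => den c2 (den c1 s)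
  | HLoop a c => countdown (fun k s => den c (setr s a k)) (reg s a) s
  end.

Fixpoint cost (c : hcmd) (s : hst) : nat :=
  match c with
  | HLoad _ _ _ | HStore _ _ _ => 6
  | HSeq c1 c2 => cost c1 s + cost c2 (den c1 s)
  | HLoop a c => countdown_cost (fun k s => den c (setr s a k))
                   (fun k s => cost c (setr s a k)) (reg s a) s
  | _ => 1
  end.

Lemma frame_reg c s r : r \notin wregs c -> reg (den c s) r = reg s r.
Proof.
elim: c s => //=; try (by move=> *; match goal with H : is_true (_ \notin [:: _]) |- _ =>
  move: H; rewrite inE /upd => /negbTE -> end).
- by move=> c1 IH1 c2 IH2 s; rewrite mem_cat negb_or => /andP[h1 h2]; rewrite IH2 ?IH1.
- move=> a c IH s; rewrite inE negb_or => /andP[ra rc].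
  move: (reg s a) => m; elim: m s => //= m IHm s'.
  by rewrite IHm IH //= /upd (negbTE ra).
Qed.

Lemma frame_arr c s k : k \notin warrs c -> arr (den c s) k = arr s k.
Proof.
elim: c s => //=.
- by move=> k' i r s; rewrite inE /upd => /negbTE->.
- by move=> c1 IH1 c2 IH2 s; rewrite mem_cat negb_or => /andP[h1 h2]; rewrite IH2 ?IH1.
- move=> a c IH s kc; move: (reg s a) => m; elim: m s => //= m IHm s'.
  by rewrite IHm IH.
Qed.

Lemma frame_rm c s : ~~ wreal c -> rm (den c s) = rm s.
Proof.
elim: c s => //=.
- by move=> c1 IH1 c2 IH2 s; rewrite negb_or => /andP[h1 h2]; rewrite IH2 ?IH1.
- move=> a c IH s kc; move: (reg s a) => m; elim: m s => //= m IHm s'.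
  by rewrite IHm IH.
Qed.

(* The invariant I is indexed by the number of remaining iterations. *)
Lemma loop_rule (I : nat -> hst -> Prop) (B : nat) a c s :
  I (reg s a) s ->
  (forall k s', k < reg s a -> I k.+1 s' ->
     I k (den c (setr s' a k)) /\ cost c (setr s' a k) <= B) ->
  I 0 (den (HLoop a c) s) /\ cost (HLoop a c) s <= reg s a * (B + 5) + 1.
Proof.
rewrite /=; move: (reg s a) => m; elim: m s => [|m IH] s Is step //=.
have [I' cB] := step m s (ltnSn _) Is.
have [I0 c0] := IH _ I' (fun k s' km => step k s' (ltnW km)).
split=> //; rewrite mulSn; move: cB c0; clear; lia.
Qed.

Definition sim (s : memory R) (h : hst) : Prop :=
  [/\ forall r, okr r -> s.1 r = reg h r,
      forall k i, k < 8 -> s.1 (cell k i) = arr h k i & s.2 = rm h].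

Lemma okr_cell r k i : okr r -> (cell k i == r) = false.
Proof. by rewrite /okr /cell; lia. Qed.

Lemma okr12 r : okr r -> ((r == 1) = false) * ((r == 2) = false).
Proof. by rewrite /okr => h; split; lia. Qed.

Lemma cell12 k i : ((cell k i == 1) = false) * ((cell k i == 2) = false).
Proof. by rewrite /cell; split; lia. Qed.

Lemma cell_inj k i k' i' : k < 8 -> k' < 8 ->
  (cell k i == cell k' i') = (k == k') && (i == i').
Proof. by rewrite /cell; lia. Qed.

Lemma sim_setr (s : memory R) N' h r v : okr r -> sim s h ->
  (forall a, a != 1 -> a != 2 -> N' a = upd s.1 r v a) ->
  sim (N', s.2) (setr h r v).
Proof.
move=> okr_r [h1 h2 h3] hN; split=> //= [q okq|k i k8].
  by rewrite hN ?(okr12 okq) // /upd h1.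
by rewrite hN ?cell12 // /upd okr_cell // h2.
Qed.

Lemma addr_codeP (s : memory R) k i (N' := (foldl (@exec_instr R) s (addr_code k i)).1) :
  okr i -> [/\ (foldl (@exec_instr R) s (addr_code k i)).2 = s.2,
    N' 2 = cell k (s.1 i) & forall a, a != 1 -> a != 2 -> N' a = s.1 a].
Proof.
rewrite {}/N' /cell; case: s => N Rm oki; split=> //= [|a /negbTE a1 /negbTE a2].
  by rewrite /upd /=; lia.
by rewrite /upd a1 a2.
Qed.

Lemma sim_ev c (s : memory R) h : wf c -> sim s h ->
  exists2 s', ev (tr c) s (cost c h) s' & sim s' (den c h).
Proof.
elim: c s h => /=.
- move=> r k s h okr_r sh; eexists; first exact: ev_block.
  by case: s sh => N Rm sh /=; apply: (sim_setr okr_r sh).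
- move=> r a b s h /and3P[okr_r oka okb] sh; eexists; first exact: ev_block.
  case: s sh => N Rm sh /=; apply: (sim_setr okr_r sh) => x _ _ /=.
  by case: sh => h1 _ _; rewrite -!h1.
- move=> r a b s h /and3P[okr_r oka okb] sh; eexists; first exact: ev_block.
  case: s sh => N Rm sh /=; apply: (sim_setr okr_r sh) => x _ _ /=.
  by case: sh => h1 _ _; rewrite -!h1.
- move=> r a b s h /and3P[okr_r oka okb] sh; eexists; first exact: ev_block.
  case: s sh => N Rm sh /=; apply: (sim_setr okr_r sh) => x _ _ /=.
  by case: sh => h1 _ _; rewrite -!h1.
- move=> k r i s h /and3P[k8 okr_r oki] sh.
  eexists; first exact: (ev_block s (l := rcons (addr_code k i) (NLoad r 2))).
  rewrite foldl_rcons; have [e2 eA eN] := addr_codeP s k oki.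
  case: (foldl _ _ _) e2 eA eN => N' Rm' /= -> eA eN.
  apply: (sim_setr okr_r sh) => x x1 x2; case: (sh) => h1 h2 _.
  by rewrite /upd eA eN ?cell12 // h2 // -h1 // eN.
- move=> k i r s h /and3P[k8 okr_r oki] sh.
  eexists; first exact: (ev_block s (l := rcons (addr_code k i) (NStore 2 r))).
  rewrite foldl_rcons; have [e2 eA eN] := addr_codeP s k oki.
  case: (foldl _ _ _) e2 eA eN => N' Rm' /= -> eA eN.
  case: sh => h1 h2 h3; split=> //= [q okq|k' j k'8]; rewrite /upd eA.
    by rewrite eq_sym okr_cell // eN ?okr12 // h1.
  rewrite cell_inj // h1 //; case: eqVneq => [->|_] /=; last by rewrite eN ?cell12 // h2.
  by case: eqP => _; rewrite eN ?cell12 ?okr12 // ?h2 ?h1.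
- move=> r a b s h /and3P[okr_r oka okb] [h1 h2 h3]; eexists; first exact: ev_block.
  by case: s h1 h2 h3 => N Rm /= h1 h2 ->; split=> //=; rewrite !h1.
- move=> r a b s h /and3P[okr_r oka okb] [h1 h2 h3]; eexists; first exact: ev_block.
  by case: s h1 h2 h3 => N Rm /= h1 h2 ->; split=> //=; rewrite !h1.
- move=> c1 IH1 c2 IH2 s h /andP[w1 w2] sh.
  have [s1 ev1 sh1] := IH1 _ _ w1 sh; have [s2 ev2 sh2] := IH2 _ _ w2 sh1.
  by exists s2 => //; apply: ev_seq ev1 ev2.
- move=> a c IH s h /and3P[oka ac wc].
  move e: (reg h a) => m; elim: m s h e => [|m IHm] s h e sh /=.
    by exists s => //; apply: ev_loop0; case: sh => h1 _ _; rewrite h1.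
  have sh1 : sim (upd (upd s.1 1 1) a m, s.2) (setr h a m).
    by apply: (sim_setr oka sh) => x x1 x2; rewrite /upd (negbTE x1).
  have [s1 ev1 [g1 g2 g3]] := IH _ _ wc sh1.
  have [||s2 ev2 sh2] := IHm (upd s1.1 1 0, s1.2) (den c (setr h a m)).
  + by rewrite frame_reg //= /upd eqxx.
  + by split=> //= r okr_r; rewrite /upd okr12 // g1.
  exists s2 => //; apply: ev_loopS ev1 ev2; first by rewrite okr12.
  by case: sh => h1 _ _; rewrite h1.
Qed.

End HighLevel.

(** * Relocating the input *)

Fixpoint unpack (e k : nat) : lcmd :=
  if k is k'.+1 then
    LSeq (LBlock [:: NConst 2 (2 ^ k'); NLt 5 3 2; NConst 4 1; NSub 5 4 5;
                     NConst 4 (cell 0 e); NStore 4 5])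
      (LSeq (LLoop 5 (LBlock [:: NSub 3 3 2])) (unpack e.+1 k'))
  else LBlock [::].

Definition pack_code (l : seq nat) : seq instr :=
  flatten [seq [:: NAdd 1 1 1; NAdd 1 1 c] | c <- l].

Definition setup_code : seq instr :=
  [:: NConst 2 0; NAdd 3 1 2; NConst 4 0; NAdd 5 0 2].

Definition move_code : seq instr :=
  [:: NConst 2 8; NAdd 5 4 2; NLoad 6 5; NConst 2 7; NAdd 5 4 2;
      NAdd 5 5 5; NAdd 5 5 5; NAdd 5 5 5; NConst 2 32; NAdd 5 5 2; NStore 5 6].

(* The input fills every cell that an instruction can address directly.  The
   bits in cells 1..7 are therefore first packed into one number, which frees
   enough registers to move the entry e from cell e+1 to [cell 0 e]; since
   [cell 0 e > e+1], moving by decreasing e never overwrites a pending entry. *)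
Definition relocate : lcmd :=
  LSeq (LBlock (pack_code [:: 2; 3; 4; 5; 6; 7] ++ setup_code))
   (LSeq (LLoop 5 (LBlock [:: NAdd 4 4 0]))
    (LSeq (LBlock [:: NConst 2 7; NSub 4 4 2])
     (LSeq (LLoop 4 (LBlock move_code)) (unpack 0 7)))).

Section Relocate.
Variable R : realType.

Lemma ev_loop_rule (I : nat -> memory R -> Prop) T a c (s : memory R) :
  a != 1 -> I (s.1 a) s ->
  (forall k s', k < s.1 a -> s'.1 a = k.+1 -> I k.+1 s' ->
     exists t s2, [/\ ev c (upd (upd s'.1 1 1) a k, s'.2) t s2, t <= T,
       s2.1 a = k & I k (upd s2.1 1 0, s2.2)]) ->
  exists t s', [/\ ev (LLoop a c) s t s', t <= s.1 a * (T + 5) + 1 & I 0 s'].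
Proof.
move=> a1; move e: (s.1 a) => m; elim: m s e => [|m IH] s e Is step.
  by exists 1, s; split=> //; apply: ev_loop0.
have [t [s1 [ev1 tT s1a I1]]] := step m s (ltnSn _) e Is.
have [||t' [s2 [ev2 t'T I2]]] := IH (upd s1.1 1 0, s1.2) _ I1.
- by rewrite /= /upd (negbTE a1).
- by move=> k s' km; apply: step; apply: ltnW.
exists (5 + t + t'), s2; split=> //; first exact: ev_loopS ev1 ev2.
by move: tT t'T; clear; rewrite mulSn; lia.
Qed.

Variable N0 : nat -> nat.
Hypothesis N0_bit : forall a, N0 a.+1 <= 1.

Fixpoint packed (e k : nat) : nat :=
  if k is k'.+1 then N0 e.+1 * 2 ^ k' + packed e.+1 k' else 0.

Lemma packed_lt e k : packed e k < 2 ^ k.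
Proof.
elim: k e => //= k IH e; rewrite expnS; have := IH e.+1; have := N0_bit e.
by case: (N0 e.+1) => [|[|]] //; lia.
Qed.

Lemma unpackP k e (s : memory R) : s.1 3 = packed e k ->
  exists t s', [/\ ev (unpack e k) s t s', t <= 13 * k, s'.2 = s.2, s'.1 0 = s.1 0 &
    forall j, s'.1 (cell 0 j) = if e <= j < e + k then N0 j.+1 else s.1 (cell 0 j)].
Proof.
elim: k e s => [|k IH] e s s3 /=.
  exists 0, s; split=> //; first exact: (@ev_block R [::]).
  by move=> j; case: ifP => //; lia.
set blk := [:: _; _; _; _; _; _].
have ev1 : ev (LBlock blk) s 6 (foldl (@exec_instr R) s blk) by apply: ev_block.
have [t2 [s2 [ev2 t2T [s23 e2 s20 s2c]]]] : exists t s', [/\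
   ev (LLoop 5 (LBlock [:: NSub 3 3 2])) (foldl (@exec_instr R) s blk) t s', t <= 7 &
   [/\ s'.1 3 = packed e.+1 k, s'.2 = s.2, s'.1 0 = s.1 0 &
   forall j, s'.1 (cell 0 j) = if j == e then N0 e.+1 else s.1 (cell 0 j)]].
  case: s s3 {ev1} => N Rm /= s3; have lt := packed_lt e.+1 k.
  have := N0_bit e; case Ne: (N0 e.+1) => [|[|]] // _.
    have b0 : N 3 < 2 ^ k by rewrite s3 Ne mul0n add0n.
    eexists 1, _; split; [by apply: ev_loop0; rewrite /= /upd /= b0|by []|split] => //=.
    - by rewrite /upd /= s3 Ne mul0n add0n.
    - by move=> j; rewrite /upd /= cell_inj //= b0.
  have b0 : (N 3 < 2 ^ k) = false by rewrite s3 Ne mul1n ltnNge leq_addr.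
  eexists (5 + 1 + 1), _; split.
  - apply: (@ev_loopS R _ _ _ 0) => //=; first by rewrite /upd /= b0.
      exact: (@ev_block R [:: NSub 3 3 2]).
    exact: ev_loop0.
  - by [].
  split=> //.
  - by rewrite /= /upd /= s3 Ne mul1n addKn.
  - by move=> j; rewrite /= /upd /= cell_inj //= b0.
have [t3 [s3' [ev3 t3T e3 s30 s3c]]] := IH _ _ s23.
exists (6 + (t2 + t3)), s3'; split.
- by apply: ev_seq ev1 _; apply: ev_seq ev2 ev3.
- by rewrite mulnS; move: t2T t3T; clear; lia.
- by rewrite e3 e2.
- by rewrite s30 s20.
move=> j; rewrite s3c s2c; case: eqVneq => [->|ne]; first by rewrite leqnn ltnn /= addnS ltnS leq_addr.
by rewrite addSnnS ltn_neqAle eq_sym ne.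
Qed.

Lemma pack_codeP l (s : memory R) (s' := foldl (@exec_instr R) s (pack_code l)) :
  all (fun c => c != 1) l ->
  [/\ s'.1 1 = foldl (fun x c => x + x + s.1 c) (s.1 1) l,
      forall a, a != 1 -> s'.1 a = s.1 a & s'.2 = s.2].
Proof.
rewrite {}/s'; elim: l s => [|c l IH] [N Rm] //= /andP[c1 hl].
set s2 := (upd _ 1 _, Rm).
have e1 : s2.1 1 = N 1 + N 1 + N c by rewrite /= /upd /= (negbTE c1).
have e2 a : a != 1 -> s2.1 a = N a by rewrite /= /upd => /negbTE->.
have e3 : s2.2 = Rm by [].
move: s2 e1 e2 e3 => s2 e1 e2 e3; have [h1 h2 h3] := IH s2 hl; split=> //.
- rewrite h1 e1; elim: l hl (_ + _) {IH h1 h2 h3} => //= q l IHl /andP[q1 hl] x.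
  by rewrite e2 // IHl.
- by move=> a a1; rewrite h2 // e2.
- by rewrite h3.
Qed.

Lemma relocateP n (Rm : nat -> R) : N0 0 = n ->
  exists t s', [/\ ev relocate (N0, Rm) t s', t <= 22 * (n * n) + 7 * n + 130,
    s'.2 = Rm, s'.1 0 = n & forall e, e < n * n -> s'.1 (cell 0 e) = N0 e.+1].
Proof.
move=> N0n; set b1 := pack_code [:: 2; 3; 4; 5; 6; 7].
set s1 := foldl (@exec_instr R) (N0, Rm) (b1 ++ setup_code).
have ev1 : ev (LBlock (b1 ++ setup_code)) (N0, Rm) 16 s1 by apply: ev_block.
have [s10 s13 s14 s15 [s1R s1N]] : [/\ s1.1 0 = n, s1.1 3 = packed 0 7, s1.1 4 = 0,
    s1.1 5 = n & s1.2 = Rm /\ forall a, 7 < a -> s1.1 a = N0 a].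
  clear ev1; rewrite {}/s1 foldl_cat.
  have := @pack_codeP [:: 2; 3; 4; 5; 6; 7] (N0, Rm) isT; rewrite -/b1.
  case: (foldl _ (N0, Rm) b1) => N Rm' /= [h1 h2 hR]; split=> //; rewrite /upd /=.
  - by rewrite h2.
  - by rewrite addn0 h1 !expnS expn0; clear; lia.
  - by rewrite addn0 h2.
  - by split=> // a; do 8 (case: a => // a); rewrite /= h2.
clearbody s1.
pose I1 m (s : memory R) := [/\ s.1 0 = n, s.1 3 = packed 0 7, s.1 4 = (n - m) * n,
  s.2 = Rm & forall a, 7 < a -> s.1 a = N0 a].
have [||t2 [s2 [ev2 t2T [s20 s23 s24 s2R s2N]]]] :=
   @ev_loop_rule I1 1 5 (LBlock [:: NAdd 4 4 0]) s1 isT.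
- by rewrite s15; split=> //; rewrite subnn.
- move=> k [N Rm']; rewrite s15 => kn /= Nk [/= h0 h3 h4 hR hN].
  eexists 1, _; split; [exact: (@ev_block R [:: NAdd 4 4 0])|by []|by []|].
  split=> //=.
  + by rewrite /upd /= h4 h0 -(subnSK kn) mulSn addnC.
  + by move=> a; do 8 (case: a => // a); rewrite /upd /= hN.
rewrite subn0 in s24; rewrite s15 in t2T.
set b3 := [:: NConst 2 7; NSub 4 4 2].
set s3 := foldl (@exec_instr R) s2 b3.
have ev3 : ev (LBlock b3) s2 2 s3 by apply: ev_block.
have [s30 s33 s34 [s3R s3N]] : [/\ s3.1 0 = n, s3.1 3 = packed 0 7, s3.1 4 = n * n - 7 &
    s3.2 = Rm /\ forall a, 7 < a -> s3.1 a = N0 a].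
  clear ev3 ev2; rewrite {}/s3; case: s2 s20 s23 s24 s2R s2N => N Rm' /= h0 h3 h4 hR hN.
  split=> //; first by rewrite /upd /= h4.
  by split=> // a; do 8 (case: a => // a); rewrite /upd /= hN.
clearbody s3.
pose I2 m (s : memory R) := [/\ s.1 0 = n, s.1 3 = packed 0 7, s.2 = Rm,
  forall a, a < m -> s.1 a.+4.+4 = N0 a.+4.+4 &
  forall a, m <= a < n * n - 7 -> s.1 (cell 0 (a + 7)) = N0 a.+4.+4].
have [||t4 [s4 [ev4 t4T [s40 s43 s4R _ s4N]]]] :=
   @ev_loop_rule I2 11 4 (LBlock move_code) s3 isT.
- rewrite s34; split=> // [a am|a am]; first exact: s3N.
  by move: am; clear; lia.
- move=> k [N Rm']; rewrite s34 => kn /= Nk [/= h0 h3 hR h1 h2].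
  eexists 11, _; split; [exact: (@ev_block R move_code)|by []| |]; rewrite /= /upd /=.
    by case: eqP => //; lia.
  set A := _ + 32; have -> : A = cell 0 (k + 7) by rewrite /A /cell; lia.
  rewrite (addnC k 8); split=> //=.
  + move=> a ak; rewrite (_ : (_ == _) = false) ?h1 //; last by rewrite /cell; lia.
    by move: ak; lia.
  + move=> a ak; case: eqVneq => [e|ne].
      have -> : a = k by move: e; rewrite /cell; lia.
      by rewrite h1.
    by rewrite /= h2 //; move: ne ak; rewrite /cell; lia.
have [t5 [s5 [ev5 t5T s5R s50 s5N]]] := unpackP s43.
exists (16 + (t2 + (2 + (t4 + t5)))), s5; split.
- by do 4 (apply: ev_seq; [eassumption|]).
- by rewrite s34 in t4T; move: t2T t4T t5T; move: (n * n) => q; clear; lia.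
- by rewrite s5R.
- by rewrite s50.
move=> e en; rewrite s5N /=; case: ifP => // /negbT; rewrite add0n -leqNgt => e7.
have := s4N (e - 7); rewrite subnK // => ->; last by move: e7 en; move: (n * n) => q; clear; lia.
by congr N0; move: e7; clear; lia.
Qed.

End Relocate.

(** * The preprocessing program *)

Section Triples.
Variable R : realType.
Implicit Types s : hst R.

Definition wp c (Q : hst R -> Prop) T s : Prop := Q (den c s) /\ cost c s <= T.

Definition same_but c s s' : Prop :=
  (forall r, r \notin wregs c -> reg s' r = reg s r) /\
  (forall k, k \notin warrs c -> arr s' k = arr s k).

Lemma wp_weaken c (Q : hst R -> Prop) T T' s : wp c Q T s -> T <= T' -> wp c Q T' s.
Proof. by case=> q t tT; split=> //; apply: leq_trans tT. Qed.

Lemma wp_post c (Q Q' : hst R -> Prop) T s : wp c Q T s ->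
  (forall s', Q s' -> same_but c s s' -> Q' s') -> wp c Q' T s.
Proof.
case=> q t h; split=> //; apply: h => //; split=> x hx; first exact: frame_reg.
exact: frame_arr.
Qed.

Lemma wp_seq c1 c2 (Q1 Q : hst R -> Prop) T1 T2 s : wp c1 Q1 T1 s ->
  (forall s', Q1 s' -> same_but c1 s s' -> wp c2 Q T2 s') ->
  wp (c1;; c2) Q (T1 + T2) s.
Proof.
case=> q t h; have [|q2 t2] := h _ q; last by split=> //=; apply: leq_add.
by split=> x hx; [exact: frame_reg|exact: frame_arr].
Qed.

Lemma wp_const r k (Q : hst R -> Prop) s : Q (setr s r k) -> wp (HConst r k) Q 1 s.
Proof. by split. Qed.
Lemma wp_add r a b (Q : hst R -> Prop) s :
  Q (setr s r (reg s a + reg s b)) -> wp (HAdd r a b) Q 1 s.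
Proof. by split. Qed.
Lemma wp_sub r a b (Q : hst R -> Prop) s :
  Q (setr s r (reg s a - reg s b)) -> wp (HSub r a b) Q 1 s.
Proof. by split. Qed.
Lemma wp_lt r a b (Q : hst R -> Prop) s :
  Q (setr s r (reg s a < reg s b)) -> wp (HLt r a b) Q 1 s.
Proof. by split. Qed.
Lemma wp_load k r i (Q : hst R -> Prop) s :
  Q (setr s r (arr s k (reg s i))) -> wp (HLoad k r i) Q 6 s.
Proof. by split. Qed.
Lemma wp_store k i r (Q : hst R -> Prop) s :
  Q (Hst (reg s) (upd (arr s) k (upd (arr s k) (reg s i) (reg s r))) (rm s)) ->
  wp (HStore k i r) Q 6 s.
Proof. by split. Qed.

Lemma wp_cons c1 c2 (Q : hst R -> Prop) T1 T2 s :
  wp c1 (wp c2 Q T2) T1 s -> wp (c1;; c2) Q (T1 + T2) s.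
Proof. by move=> [[q t2] t1]; split=> //=; apply: leq_add. Qed.

Lemma wp_loop (I : nat -> hst R -> Prop) B a c s :
  I (reg s a) s ->
  (forall k s', k < reg s a -> I k.+1 s' -> same_but (HLoop a c) s s' ->
     wp c (I k) B (setr s' a k)) ->
  wp (HLoop a c) (I 0) (reg s a * (B + 5) + 1) s.
Proof.
move=> Is step.
have [||[I0 _] t0] := @loop_rule R (fun k s' => I k s' /\ same_but (HLoop a c) s s') B a c s.
- by [].
- move=> k s' ka [Ik fr]; have [q t] := step k s' ka Ik fr; split=> //; split=> //.
  case: fr => fr fa; split=> x /= hx.
    rewrite frame_reg; last by move: hx; rewrite inE negb_or => /andP[].
    rewrite /= /upd; case: eqP hx => [->|_ hx]; first by rewrite inE eqxx.
    exact: fr.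
  by rewrite frame_arr //= fa.
by split.
Qed.

(* Loops on a register holding a bit serve as conditionals. *)
Lemma wp_if (b : bool) (Q : hst R -> Prop) B a c s : reg s a = b ->
  (b -> wp c Q B (setr s a 0)) -> (~~ b -> Q s) -> wp (HLoop a c) Q (B + 6) s.
Proof.
case: b => e h1 h2.
  have [q t] := h1 isT; split; rewrite /= e //=.
  by move: t; clear; lia.
by split; rewrite /= e //=; [exact: h2|clear; lia].
Qed.

End Triples.

Ltac wstep := first
  [ apply: wp_cons; first [apply: wp_const | apply: wp_add | apply: wp_sub | apply: wp_lt
     | apply: wp_load | apply: wp_store]
  | first [apply: wp_const | apply: wp_add | apply: wp_sub | apply: wp_lt
     | apply: wp_load | apply: wp_store] ].

(* While row i is processed, X = 2 ^ rW, rZ = X ^ i, rOnes = sum_(j < i) X ^ j,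
   rV packs the distances of row i to the earlier rows, rP is the current best
   parent, rIn, rJn and rPn are the offsets i n, j n, p n into the matrix, and rL
   is the length of the tape.  Array 0 is the matrix, array 1 the packed columns,
   and arrays 2 to 6 are the fields of the tape. *)
Notation rn := 0.   Notation rW := 3.   Notation rQ := 4.   Notation rOne := 5.
Notation rZ := 6.   Notation rOnes := 7. Notation rI := 8.  Notation rIn := 9.
Notation rA := 10.  Notation rK := 11.  Notation rV := 12.  Notation rB := 13.
Notation rC := 14.  Notation rX := 15.  Notation rT := 16.  Notation rJ := 17.
Notation rJn := 18. Notation rD := 19.  Notation rBest := 20. Notation rP := 21.
Notation rPL := 22. Notation rPn := 23. Notation rL := 24.  Notation rU := 25.
Notation rTw := 26. Notation rNN := 27. Notation rZero := 28.

Definition width_prog : hcmd :=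
  HConst rW 0;; HConst rQ 1;; HAdd rA rn rZero;;
  HLoop rA (HLt rB rn rQ;; HSub rB rOne rB;;
            HLoop rB (HAdd rQ rQ rQ;; HAdd rW rW rOne)).

Definition clear_prog : hcmd :=
  HConst rNN 0;; HAdd rA rn rZero;; HLoop rA (HAdd rNN rNN rn);;
  HAdd rK rn rZero;;
  HLoop rK (HStore 1 rK rZero;; HAdd rT rNN rK;; HStore 0 rT rZero).

Definition pack_prog : hcmd :=
  HConst rV 0;; HAdd rK rn rZero;;
  HLoop rK (HAdd rT rIn rK;; HLoad 0 rB rT;; HLoad 1 rC rK;; HAdd rX rC rZero;;
            HLoop rB (HSub rX rOnes rC;; HAdd rC rC rZ;; HStore 1 rK rC);;
            HAdd rV rV rX).

Definition digit_prog : hcmd :=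
  HConst rD 0;; HAdd rTw rW rZero;;
  HLoop rTw (HAdd rV rV rV;; HLt rB rV rZ;; HSub rB rOne rB;;
             HAdd rD rD rD;; HAdd rD rD rB;; HLoop rB (HSub rV rV rZ)).

Definition argmin_prog : hcmd :=
  HAdd rBest rn rOne;; HAdd rP rn rZero;; HAdd rPL rn rn;; HAdd rPn rNN rZero;;
  HAdd rJ rI rZero;; HAdd rJn rIn rZero;;
  HLoop rJ (HSub rJn rJn rn;; digit_prog;; HLt rB rD rBest;;
            HLoop rB (HAdd rBest rD rZero;; HAdd rP rJ rZero;; HAdd rPL rJ rZero;;
                      HAdd rPn rJn rZero)).

Definition emit (a b c d e : nat) : hcmd :=
  HStore 2 rL a;; HStore 3 rL b;; HStore 4 rL c;; HStore 5 rL d;; HStore 6 rL e;;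
  HAdd rL rL rOne.

Definition emit_prog : hcmd :=
  HAdd rX rn rI;; HAdd rT rn rP;; emit rX rT rPL rI rOne;;
  HAdd rK rn rZero;;
  HLoop rK (HAdd rT rIn rK;; HLoad 0 rB rT;; HAdd rT rPn rK;; HLoad 0 rC rT;;
            HSub rD rB rC;; HSub rU rC rB;; HAdd rD rD rU;; HAdd rU rn rK;;
            HLoop rD (emit rX rK rU rI rB)).

Definition next_prog : hcmd :=
  HAdd rI rI rOne;; HAdd rIn rIn rn;; HAdd rOnes rOnes rZ;; HAdd rTw rW rZero;;
  HLoop rTw (HAdd rZ rZ rZ).

Definition row_prog : hcmd := pack_prog;; argmin_prog;; emit_prog;; next_prog.

Definition main_prog : hcmd :=
  HConst rOne 1;; HConst rZero 0;; width_prog;; clear_prog;;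
  HConst rL 0;; HConst rI 0;; HConst rIn 0;; HConst rZ 1;; HConst rOnes 0;;
  HAdd rA rn rZero;; HLoop rA row_prog.

(* An operation of the tape: real cell dR receives +- real cell sR in the
   product M v, and cell dL receives +- cell sL in the product v^T M. *)
Record op := Op { dR : nat; sR : nat; dL : nat; sL : nat; sg : bool }.
Definition op0 := Op 0 0 0 0 true.

Section Preprocessing.
Variable R : realType.
Variable n : nat.
Implicit Types s : hst R.

Definition consts s : Prop := [/\ reg s rn = n, reg s rOne = 1 & reg s rZero = 0].

Lemma consts_same c s s' : consts s -> same_but c s s' ->
  [&& rn \notin wregs c, rOne \notin wregs c & rZero \notin wregs c] -> consts s'.
Proof. by move=> [h1 h2 h3] [fr _] /and3P[g1 g2 g3]; split; rewrite fr. Qed.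

Lemma width_progP s : consts s ->
  wp width_prog (fun s' => n < 2 ^ reg s' rW /\ reg s' rW <= lg n) (15 * n + 4) s.
Proof.
move=> [h0 h1 hz].
pose I k s' := [/\ reg s' rQ = 2 ^ reg s' rW,
  reg s' rW = 0 \/ 2 ^ (reg s' rW).-1 <= n & n < 2 ^ reg s' rW \/ reg s' rW = n - k].
apply: wp_weaken.
  do 3 wstep; rewrite /= /upd /= h0 hz addn0.
  apply: wp_post; first (apply: (@wp_loop R I 10)).
  - by rewrite /= /upd /=; split=> //=; [left|right; rewrite /= subnn].
  - move=> k s' /=; rewrite /upd /= => kn [i1 i2 i3] [fr _].
    have s0 : reg s' 0 = n by rewrite fr //= /upd /= h0.
    have s1 : reg s' 5 = 1 by rewrite fr //= /upd /= h1.
    apply: wp_weaken; first (do 2 wstep; apply: (@wp_if R (2 ^ reg s' rW <= n))).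
    + by rewrite /= /upd /= s0 s1 i1 ltnNge; case: (_ <= _).
    + move=> le; do 2 wstep; rewrite /I /= /upd /= s1 i1 addn1 addnn -mul2n -expnS; split=> //.
        by right.
      case: i3 => [|->]; first by rewrite ltnNge le.
      by right; rewrite subnSK.
    + rewrite -ltnNge => gt; split; rewrite /= /upd //=; by left.
    + by [].
  move=> s' [i1 i2 i3] _; split.
    by case: i3 => // ->; rewrite subn0 ltn_expl.
  case: i2 => [->//|]; case: (reg s' rW) => // w /= le.
  by rewrite /lg ltnS trunc_log_max.
by rewrite /= /upd /=; clear; lia.
Qed.

Lemma clear_progP s : consts s ->
  wp clear_prog (fun s' => [/\ reg s' rNN = n * n,
     forall e, e < n * n -> arr s' 0 e = arr s 0 e,
     forall k, k < n -> arr s' 0 (n * n + k) = 0 &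
     forall k, k < n -> arr s' 1 k = 0]) (24 * n + 5) s.
Proof.
move=> [h0 h1 hz].
pose I1 k s' := reg s' rNN = (n - k) * n.
pose I2 k s' := [/\ forall e, e < n * n -> arr s' 0 e = arr s 0 e,
     forall k', k <= k' < n -> arr s' 0 (n * n + k') = 0 &
     forall k', k <= k' < n -> arr s' 1 k' = 0].
apply: wp_weaken.
  do 2 wstep; apply: (wp_seq (T2 := 18 * n + 2)); first (apply: (@wp_loop R I1 1)).
  - by rewrite /I1 /= /upd /= h0 hz addn0 subnn.
  - move=> k s' /=; rewrite /upd /= h0 hz addn0 => kn i1 [fr _].
    wstep; rewrite /I1 /= /upd /= (fr 0) //= /upd /= h0 i1 -(subnSK kn) mulSn addnC //.
  move=> s1; rewrite /I1 subn0 => nn1 [fr fa].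
  have s10 : reg s1 0 = n by rewrite fr //= /upd /= h0.
  have s1z : reg s1 28 = 0 by rewrite fr //= /upd /= hz.
  apply: wp_weaken; first (wstep; apply: wp_post; first (apply: (@wp_loop R I2 13))).
  - split=> [e _|k|k]; rewrite /= /upd /= ?s10 ?s1z ?fa //; clear; lia.
  - move=> k s2; rewrite /= /upd /= s10 s1z addn0 => kn [i1 i2 i3] [fr2 _].
    have s2z : reg s2 28 = 0 by rewrite fr2 //= /upd /= s1z.
    have s2n : reg s2 27 = n * n by rewrite fr2 //= /upd /= nn1.
    apply: (@wp_weaken _ _ _ (6 + (1 + 6))) => //.
    do 3 wstep; rewrite /I2 /= /upd /= s2z s2n; split=> [e en|k' kk|k' kk].
    + by rewrite (_ : (_ == _) = false) ?i1 //; apply/negbTE; rewrite neq_ltn (leq_trans en) ?leq_addr.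
    + by rewrite eqn_add2l; case: eqP => // ne; apply: i2; move: kk ne; clear; lia.
    + by case: eqP => // ne; apply: i3; move: kk ne; clear; lia.
  - move=> s3 [i1 i2 i3] [fr3 _]; split=> //.
    by rewrite fr3 //= /upd /= nn1.
  by rewrite /= /upd /= s10 s1z addn0; clear; lia.
by rewrite /= /upd /= h0 hz addn0; clear; lia.
Qed.

Variable m : nat -> nat -> bool.
Variable w : nat.
Hypothesis n_lt_w : n < 2 ^ w.
Notation X := (2 ^ w).

Definition acc i k := \sum_(j < i) m j k * X ^ j.
Definition ones i := \sum_(j < i) X ^ j.
Definition col i k := \sum_(j < i) (m i k != m j k) * X ^ j.
Definition ham i j := \sum_(k < n) (m i k != m j k).
Definition digits (D : nat -> nat) i := \sum_(j < i) D j * X ^ j.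

Lemma col_true i k : m i k -> col i k = ones i - acc i k.
Proof.
move=> mik; rewrite -[LHS](addKn (acc i k)) -big_split /=; congr (_ - _).
by apply: eq_bigr => j _; rewrite mik -mulnDl; case: (m j k); rewrite mul1n.
Qed.

Lemma col_false i k : ~~ m i k -> col i k = acc i k.
Proof. by move=> /negbTE mik; apply: eq_bigr => j _; rewrite mik; case: (m j k). Qed.

Lemma ham_le i j : ham i j <= n.
Proof.
rewrite -[X in _ <= X]card_ord -sum1_card; apply: leq_sum => k _.
by case: (_ != _).
Qed.

Lemma sum_col i : \sum_(k < n) col i k = digits (ham i) i.
Proof.
by rewrite exchange_big /=; apply: eq_bigr => j _; rewrite big_distrl.
Qed.

Lemma digits_lt D i : (forall j, j < i -> D j < X) -> digits D i < X ^ i.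
Proof.
elim: i => [|i IH] hD; first by rewrite /digits big_ord0.
rewrite /digits big_ord_recr /= -/(digits D i) expnS.
have lt := IH (fun j ji => hD j (ltnW ji)).
have le : (D i).+1 * X ^ i <= X * X ^ i by rewrite leq_mul2r hD ?orbT.
by apply: leq_trans le; rewrite mulSn ltn_add2r.
Qed.

Lemma digits_shift_lt D i j : (forall l, D l < X) -> j <= i ->
  digits D j * X ^ (i - j) < X ^ i.
Proof.
move=> hD ji; rewrite -[in X in _ < X](subnKC ji) expnD ltn_pmul2r ?expn_gt0 ?expn_gt0 //.
by apply: digits_lt.
Qed.

Lemma top_digit D i j (V := digits D j.+1 * X ^ (i - j.+1)) :
  (forall l, D l < X) -> j < i ->
  (V * X) %/ X ^ i = D j /\ (V * X) %% X ^ i = digits D j * X ^ (i - j).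
Proof.
move=> hD ji; have -> : V * X = D j * X ^ i + digits D j * X ^ (i - j).
  rewrite /V -mulnA -expnSr subnSK // /digits big_ord_recr /= mulnDl addnC.
  by rewrite -mulnA -expnD subnKC ?(ltnW ji).
have lt := digits_shift_lt hD (ltnW ji).
by rewrite divnMDl ?modnMDl ?divn_small ?modn_small ?addn0 ?expn_gt0 ?expn_gt0.
Qed.

Definition pack_post i (s' : hst R) :=
  reg s' rV = \sum_(k < n) col i k /\ forall k, k < n -> arr s' 1 k = acc i.+1 k.

Lemma pack_progP i s : consts s -> reg s rIn = i * n -> reg s rOnes = ones i ->
  reg s rZ = X ^ i -> (forall k, k < n -> arr s 0 (i * n + k) = m i k) ->
  (forall k, k < n -> arr s 1 k = acc i k) ->
  wp pack_prog (pack_post i) (34 * n + 3) s.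
Proof.
move=> [h0 h1 hz] hIn hOnes hZ hM hAcc.
pose I k s' := reg s' rV = \sum_(k <= j < n) col i j /\
  forall j, j < n -> arr s' 1 j = if j < k then acc i j else acc i.+1 j.
apply: wp_weaken.
  do 2 wstep; apply: wp_post; first (apply: (@wp_loop R I 29)).
  - rewrite /= /upd /= h0 hz addn0; split=> /=; first by rewrite /upd big_geq.
    by move=> j jn; rewrite jn hAcc.
  - move=> k s' /=; rewrite /upd /= h0 hz addn0 => kn [i1 i2] [fr fa].
    have fr' r : r \notin wregs pack_prog -> reg s' r = reg s r.
      move=> hr; rewrite fr; last first.
        by move: hr; rewrite /pack_prog /= !inE !negb_or => /and3P[_ _].
      rewrite /= /upd; move: hr; rewrite /pack_prog /= !inE !negb_or.
      by move=> /and3P[/negbTE-> /negbTE-> _].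
    have s'M : arr s' 0 (i * n + k) = m i k by rewrite fa //= hM.
    have s'A : arr s' 1 k = acc i k by rewrite i2 ?ltnSn.
    apply: wp_weaken; first (do 4 wstep; apply: (wp_seq (T2 := 1))).
    + apply: (@wp_if R (m i k) (fun s2 => [/\ reg s2 rX = col i k,
        forall j, arr s2 1 j = if j == k then acc i.+1 k else arr s' 1 j &
        reg s2 rV = reg s' rV]) 8).
      * by rewrite /= /upd /= (fr' 9) // hIn s'M.
      * move=> mik; apply: (@wp_weaken _ _ _ (1 + (1 + 6))) => //.
        do 3 wstep; rewrite /= /upd /= (fr' 7) // (fr' 6) // hOnes hZ s'A; split=> //.
          by rewrite col_true.
        by move=> j; rewrite /acc big_ord_recr /= mik mul1n.
      * move=> nmik; rewrite /= /upd /= (fr' 28) // hz s'A addn0 col_false //; split=> // j.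
        by case: eqP => // ->; rewrite /acc big_ord_recr /= (negbTE nmik) addn0 -/(acc i k) -s'A.
    + move=> s2 [e1 e2 e3] _; wstep; rewrite /I /= /upd /= e1 e3 i1; split.
        by rewrite [RHS]big_ltn // addnC.
      move=> j jn; rewrite e2 i2 //; case: (ltngtP j k) => [lt|lt|->] //.
      * by rewrite ltnS ltnW.
      * by rewrite ltnS leqNgt lt.
    + by [].
  move=> s' [i1 i2] _; split; first by rewrite i1 big_mkord.
  by move=> k kn; rewrite i2.
by rewrite /= /upd /= h0 hz addn0; clear; lia.
Qed.

Lemma digit_progP s : consts s -> reg s rW = w -> reg s rV < reg s rZ ->
  wp digit_prog (fun s' => reg s' rD = (reg s rV * X) %/ reg s rZ /\
     reg s' rV = (reg s rV * X) %% reg s rZ) (17 * w + 3) s.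
Proof.
move=> [h0 h1 hz] hW; set V := reg s rV; set Z := reg s rZ => VZ.
pose I k s' := reg s' rD * Z + reg s' rV = V * 2 ^ (w - k) /\ reg s' rV < Z.
apply: wp_weaken.
  do 2 wstep; apply: wp_post; first (apply: (@wp_loop R I 12)).
  - by rewrite /I /= /upd /= hW hz addn0 subnn mul0n muln1.
  - move=> k s' /=; rewrite /upd /= hW hz addn0 => kw [i1 i2] [fr _].
    have s1 : reg s' 5 = 1 by rewrite fr //= /upd /= h1.
    have sZ : reg s' 6 = Z by rewrite fr //= /upd /=.
    have e2 : V * 2 ^ (w - k) = (V * 2 ^ (w - k.+1)).*2.
      by rewrite -(subnSK kw) expnS mulnCA mul2n.
    rewrite -i1 in e2.
    apply: wp_weaken.
      do 5 wstep; apply: (@wp_if R (Z <= reg s' rV + reg s' rV) _ 1).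
      + by rewrite /= /upd /= s1 sZ ltnNge; case: (_ <= _).
      + move=> le; wstep; rewrite /I /= /upd /= sZ s1 e2 ltnNge le subn0.
        by move: le i2; move: (reg s' 19) (reg s' 12) => D v; rewrite !mulnDl; clear; split; lia.
      + move=> lt; rewrite /I /= /upd /= sZ s1 e2 ltnNge lt subnn.
        by move: lt i2; move: (reg s' 19) (reg s' 12) => D v; rewrite !mulnDl; clear; split; lia.
    by [].
  move=> s' [i1 i2] _; rewrite subn0 in i1; have Z0 : 0 < Z by apply: leq_trans VZ.
  by rewrite -i1 divnMDl // modnMDl divn_small // modn_small // addn0.
by rewrite /= /upd /= hW hz addn0; clear; lia.
Qed.

(* The zero row is stored as row n, and serves as the parent of row 0. *)
Definition parent_ok i p : Prop :=
  (i = 0 /\ p = n) \/ (p < i /\ forall j, j < i -> ham i p <= ham i j).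
Definition lcell p := if p == n then n + n else p.

Lemma argmin_progP i s : consts s -> i < n -> reg s rW = w -> reg s rI = i ->
  reg s rIn = i * n -> reg s rNN = n * n -> reg s rZ = X ^ i ->
  reg s rV = digits (ham i) i ->
  wp argmin_prog (fun s' => exists p, [/\ parent_ok i p, reg s' rP = p,
    reg s' rPL = lcell p & reg s' rPn = p * n]) (n * (17 * w + 20) + 7) s.
Proof.
move=> hc i_n hW hI hIn hNN hZ hV; have [h0 h1 hz] := hc.
pose I j s' := [/\ reg s' rV = digits (ham i) j * X ^ (i - j), reg s' rJn = j * n,
  forall l, j <= l < i -> reg s' rBest <= ham i l &
  exists p, [/\ reg s' rP = p, reg s' rPL = lcell p, reg s' rPn = p * n &
    (p < i /\ reg s' rBest = ham i p) \/ (p = n /\ reg s' rBest = n.+1)]].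
have ham_lt j : ham i j < X by apply: leq_ltn_trans (ham_le i j) n_lt_w.
apply: wp_weaken.
  do 6 wstep; apply: wp_post; first (apply: (@wp_loop R I (17 * w + 15))).
  - rewrite /I /= /upd /= h0 h1 hz hI hIn hNN !addn0; split=> //.
    + by rewrite subnn muln1.
    + by move=> l; clear; lia.
    + exists n; split=> //; first by rewrite /lcell eqxx.
      by right; rewrite addn1.
  - move=> j s'; rewrite [reg _ rJ]/= /upd [X in X -> _]/= hI hz addn0 => ji [i1 i2 i3 i4] [fr _].
    have fr' r : r \notin wregs argmin_prog -> reg s' r = reg s r.
      move=> hr; rewrite fr; last first.
        by move: hr; rewrite /argmin_prog /= !inE !negb_or; do 6 (case/andP => _).
      rewrite /= /upd; move: hr; rewrite /argmin_prog /= !inE !negb_or.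
      by do 6 (case/andP => /negbTE ->).
    apply: wp_weaken.
      wstep; apply: (wp_seq (T2 := 11)); first apply: digit_progP.
      + by split; rewrite /= /upd /= fr'.
      + by rewrite /= /upd /= fr'.
      + rewrite /= /upd /= (fr' 6) // hZ i1.
        exact: digits_shift_lt.
      move=> s2; rewrite /= /upd /= (fr' 6) // hZ i1.
      have [-> ->] := top_digit ham_lt ji; move=> [e1 e2] [fr2 _].
      have r20 : reg s2 20 = reg s' 20 by rewrite fr2.
      have r28 : reg s2 28 = 0 by rewrite fr2 //= /upd /= (fr' 28) // hz.
      have r17 : reg s2 17 = j by rewrite fr2.
      have r18 : reg s2 18 = j * n by rewrite fr2 //= /upd /= (fr' 0) // h0 i2 mulSn addKn.
      case: i4 => p [p1 p2 p3 p4].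
      apply: (@wp_weaken _ _ _ (1 + (1 + (1 + (1 + 1)) + 6))) => //.
      wstep; apply: (@wp_if R (ham i j < reg s' 20)).
      * by rewrite /= /upd /= e1 r20.
      * move=> lt; do 4 wstep; rewrite /I /= /upd /= r28 r17 r18 e1 e2 !addn0; split=> //.
          move=> l; rewrite leq_eqVlt => /andP[/orP[/eqP<-//|jl li]].
          by apply: leq_trans (ltnW lt) _; apply: i3; rewrite jl.
        exists j; split=> //; last by left.
        by rewrite /lcell ltn_eqF // (ltn_trans ji).
      * rewrite -leqNgt => le; rewrite /I /= /upd /= e2 r18 r20; split=> //.
          move=> l; rewrite leq_eqVlt => /andP[/orP[/eqP<-//|jl li]].
          by apply: i3; rewrite jl.
        by exists p; rewrite !fr2.
    by clear; lia.
  move=> s' [_ _ i3 [p [p1 p2 p3 p4]]] _; exists p; split=> //.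
  case: (posnP i) => [i0|i0].
    by left; split=> //; case: p4 => [[]|[]//]; rewrite i0.
  right; case: p4 => [[pi e]|[_ e]].
    by split=> // j ji; rewrite -e; apply: i3.
  by have := i3 0 i0; rewrite e ltnNge ham_le.
rewrite /= /upd /= hI hz addn0.
have := leq_mul (ltnW i_n) (leqnn (17 * w + 20)).
by rewrite -[_ + 15 + 5]addnA; move: (i * _) (n * _) => x y; clear; lia.
Qed.

Definition holds_tape s (ops : seq op) : Prop :=
  reg s rL = size ops /\ forall t, t < size ops -> let o := nth op0 ops t in
    [/\ arr s 2 t = dR o, arr s 3 t = sR o, arr s 4 t = dL o, arr s 5 t = sL o &
        arr s 6 t = sg o].

Lemma emitP a b c d e (bit : bool) s ops : consts s -> holds_tape s ops ->
  reg s e = bit ->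
  wp (emit a b c d e) (fun s' => holds_tape s'
    (rcons ops (Op (reg s a) (reg s b) (reg s c) (reg s d) bit))) 31 s.
Proof.
move=> [h0 h1 hz] [hL hT] he; apply: (@wp_weaken _ _ _ (6 + (6 + (6 + (6 + (6 + 1)))))) => //.
do 6 wstep; split; first by rewrite /= /upd /= h1 hL size_rcons addn1.
rewrite size_rcons /= /upd /= => t; rewrite ltnS leq_eqVlt nth_rcons hL => /orP[/eqP->|lt].
  by rewrite ltnn eqxx he.
by rewrite lt ltn_eqF //; apply: hT.
Qed.

Definition diff_ops i p k : seq op :=
  [seq Op (n + i) l (n + l) i (m i l) | l <- rev (iota k (n - k)) & m i l != m p l].
Definition row_ops i p : seq op :=
  Op (n + i) (n + p) (lcell p) i true :: diff_ops i p 0.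

Lemma diff_opsS i p k : k < n -> diff_ops i p k =
  diff_ops i p k.+1 ++ (if m i k != m p k then [:: Op (n + i) k (n + k) i (m i k)] else [::]).
Proof.
move=> kn; rewrite /diff_ops -(subnSK kn) /= rev_cons filter_rcons.
by case: ifP => _; rewrite ?map_rcons ?cats1 ?cats0.
Qed.

Lemma emit_progP i p s ops : consts s -> reg s rI = i -> reg s rP = p ->
  reg s rPL = lcell p -> reg s rIn = i * n -> reg s rPn = p * n ->
  (forall k, k < n -> arr s 0 (i * n + k) = m i k) ->
  (forall k, k < n -> arr s 0 (p * n + k) = m p k) ->
  holds_tape s ops ->
  wp emit_prog (fun s' => holds_tape s' (ops ++ row_ops i p)) (60 * n + 35) s.
Proof.
move=> hc hI hP hPL hIn hPn hMi hMp hT; have [h0 h1 hz] := hc.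
pose I k s' := holds_tape s' (ops ++ Op (n + i) (n + p) (lcell p) i true :: diff_ops i p k).
apply: wp_weaken.
  do 2 wstep; apply: (wp_seq (T2 := 60 * n + 2)).
    by apply: (@emitP _ _ _ _ _ true _ ops) => //; rewrite /= /upd /= h1.
  move=> s1; rewrite /= /upd /= h0 hI hP hPL => t1 [fr fa].
  have s10 : reg s1 0 = n by rewrite fr.
  have s1z : reg s1 28 = 0 by rewrite fr.
  apply: wp_weaken; first (wstep; apply: wp_post; first (apply: (@wp_loop R I 55))).
  - by rewrite /= /upd /= s10 s1z addn0 /I /diff_ops subnn /= cats1.
  - move=> k s'; rewrite [reg _ rK]/= /upd [X in X -> _]/= s10 s1z addn0 => kn i1 [fr2 fa2].
    have r5 : reg s' 5 = 1 by rewrite fr2 //= /upd /= fr.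
    have r0 : reg s' 0 = n by rewrite fr2.
    have rz : reg s' 28 = 0 by rewrite fr2.
    have r8 : reg s' 8 = i by rewrite fr2 //= /upd /= fr.
    have r9 : reg s' 9 = i * n by rewrite fr2 //= /upd /= fr.
    have r23 : reg s' 23 = p * n by rewrite fr2 //= /upd /= fr.
    have r15 : reg s' 15 = n + i by rewrite fr2 //= /upd /= fr //= /upd /= h0 hI.
    have a0 : arr s' 0 = arr s 0 by rewrite fa2 //= fa.
    apply: wp_weaken; first (do 8 wstep; apply: (@wp_if R (m i k != m p k) _ 31)).
    + rewrite /= /upd /= a0 r9 r23 hMi // hMp //.
      by case: (m i k); case: (m p k).
    + move=> ne; apply: wp_post; first apply: (@emitP rX rK rU rI rB (m i k) _
        (ops ++ Op (n + i) (n + p) (lcell p) i true :: diff_ops i p k.+1)).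
      * by split; rewrite /= /upd /=.
      * exact: i1.
      * by rewrite /= /upd /= a0 r9 hMi.
      * move=> s2; rewrite /= /upd /= r15 r8 r0 => t2 _.
        by rewrite /I diff_opsS // ne cats1 -rcons_cons -rcons_cat.
    + by move=> e; rewrite /I diff_opsS // (negbTE e) cats0.
    + by [].
  - by move=> s' t2 _.
  by rewrite /= /upd /= s10 s1z addn0; clear; lia.
by clear; lia.
Qed.

Lemma next_progP i s : consts s -> reg s rW = w -> reg s rI = i ->
  reg s rIn = i * n -> reg s rZ = X ^ i -> reg s rOnes = ones i ->
  wp next_prog (fun s' => [/\ reg s' rI = i.+1, reg s' rIn = i.+1 * n,
    reg s' rZ = X ^ i.+1 & reg s' rOnes = ones i.+1]) (6 * w + 5) s.
Proof.
move=> [h0 h1 hz] hW hI hIn hZ hO.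
pose I k s' := reg s' rZ = X ^ i * 2 ^ (w - k).
apply: wp_weaken.
  do 4 wstep; apply: wp_post; first (apply: (@wp_loop R I 1)).
  - by rewrite /I /= /upd /= hW hz addn0 subnn muln1.
  - move=> k s'; rewrite [reg _ rTw]/= /upd [X in X -> _]/= hW hz addn0 => kw i1 _.
    by wstep; rewrite /I /= /upd /= i1 addnn -mul2n mulnCA -expnS subnSK.
  move=> s'; rewrite /I subn0 => e [fr _]; split.
  - by rewrite fr //= /upd /= hI h1 addn1.
  - by rewrite fr //= /upd /= hIn h0 mulSn addnC.
  - by rewrite e mulnC -expnS.
  - by rewrite fr //= /upd /= hO hZ /ones big_ord_recr.
by rewrite /= /upd /= hW hz addn0; clear; lia.
Qed.

End Preprocessing.

Section Rows.
Variable R : realType.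
Variables (n : nat) (m : nat -> nat -> bool) (w : nat).
Hypothesis n_lt_w : n < 2 ^ w.
Implicit Types s : hst R.

Lemma holds_tape_same c s s' ops : holds_tape s ops -> same_but c s s' ->
  (rL \notin wregs c) && all (fun k => k \notin warrs c) [:: 2; 3; 4; 5; 6] ->
  holds_tape s' ops.
Proof.
move=> [hL hT] [fr fa] /andP[cL /and5P[c2 c3 c4 c5 /andP[c6 _]]].
by split=> [|t lt]; rewrite ?fr ?fa //; apply: hT.
Qed.

Definition tape_of (ps : seq nat) : seq op :=
  flatten [seq row_ops n m x.1 x.2 | x <- zip (iota 0 (size ps)) ps].

Lemma tape_of_rcons ps p : tape_of (rcons ps p) = tape_of ps ++ row_ops n m (size ps) p.
Proof.
rewrite /tape_of size_rcons -addn1 iotaD cats1 zip_rcons ?size_iota //.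
by rewrite map_rcons flatten_rcons.
Qed.

Definition tree (ps : seq nat) : Prop :=
  forall i, i < size ps -> parent_ok n m i (nth 0 ps i).

Record inv i s : Prop := Inv {
  inv_consts : consts n s;
  inv_W : reg s rW = w;
  inv_NN : reg s rNN = n * n;
  inv_I : reg s rI = i;
  inv_In : reg s rIn = i * n;
  inv_Z : reg s rZ = (2 ^ w) ^ i;
  inv_Ones : reg s rOnes = ones w i;
  inv_M : forall r k, r <= n -> k < n -> arr s 0 (r * n + k) = m r k;
  inv_Acc : forall k, k < n -> arr s 1 k = acc m w i k;
  inv_tape : exists ps, [/\ size ps = i, tree ps & holds_tape s (tape_of ps)] }.

Definition row_cost := 114 * n + n * (17 * w) + 6 * w + 50.

Lemma row_progP i s : i < n -> inv i s -> wp row_prog (inv i.+1) row_cost s.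
Proof.
move=> i_n [hc hW hNN hI hIn hZ hO hM hA [ps [ps_i ps_tree hT]]].
apply: (@wp_weaken _ _ _ ((34 * n + 3) +
  ((n * (17 * w + 20) + 7) + ((60 * n + 35) + (6 * w + 5))))); last first.
  by rewrite /row_cost mulnDr; move: (n * (17 * w)) => x; clear; lia.
apply: wp_seq.
  by apply: (pack_progP hc hIn hO hZ _ hA) => k kn; rewrite hM ?(ltnW i_n).
move=> s1 [V1 A1] fs1; have [fr1 fa1] := fs1.
have c1 := consts_same hc fs1 isT; have T1 := holds_tape_same hT fs1 isT.
apply: wp_seq.
  by apply: (argmin_progP (m := m) n_lt_w c1 i_n); rewrite ?V1 ?sum_col ?fr1.
move=> s2 [p [ok_p P2 PL2 Pn2]] fs2; have [fr2 fa2] := fs2.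
have c2 := consts_same c1 fs2 isT; have T2 := holds_tape_same T1 fs2 isT.
have pn : p <= n by case: ok_p => [[_ ->]//|[pi _]]; rewrite ltnW // (ltn_trans pi).
have M2 : arr s2 0 = arr s 0 by rewrite fa2 // fa1.
apply: wp_seq.
  apply: (emit_progP (m := m) (i := i) c2 _ P2 PL2 _ Pn2 _ _ T2).
  - by rewrite fr2 // fr1.
  - by rewrite fr2 // fr1.
  - by move=> k kn; rewrite M2 hM // ltnW.
  - by move=> k kn; rewrite M2 hM.
move=> s3 T3 fs3; have [fr3 fa3] := fs3; have c3 := consts_same c2 fs3 isT.
apply: wp_post; first by apply: (@next_progP R n w i) => //; rewrite fr3 // fr2 // fr1.
move=> s4 [I4 In4 Z4 O4] fs4; have [fr4 fa4] := fs4.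
split=> //.
- exact: consts_same c3 fs4 isT.
- by rewrite fr4 // fr3 // fr2 // fr1.
- by rewrite fr4 // fr3 // fr2 // fr1.
- by move=> r k rn kn; rewrite fa4 // fa3 // M2 hM.
- by move=> k kn; rewrite fa4 // fa3 // fa2 // A1.
exists (rcons ps p); split; first by rewrite size_rcons ps_i.
  move=> r; rewrite size_rcons ltnS leq_eqVlt nth_rcons => /orP[/eqP->|lt].
    by rewrite ltnn eqxx ps_i.
  by rewrite lt; apply: ps_tree.
by rewrite tape_of_rcons ps_i; apply: (holds_tape_same T3 fs4).
Qed.

End Rows.

Lemma main_progP (R : realType) n (m : nat -> nat -> bool) (s : hst R) :
  reg s rn = n -> (forall r k, r < n -> k < n -> arr s 0 (r * n + k) = m r k) ->
  (forall k, m n k = false) ->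
  wp main_prog (fun s' => exists ps,
    [/\ size ps = n, tree n m ps & holds_tape s' (tape_of n m ps)])
    (400 * n.+1 ^ 2 * lg n) s.
Proof.
move=> hn hM m0.
pose B := n * (114 * n + n * (17 * lg n) + 6 * lg n + 55) + 1.
have lg0 : 0 < lg n by [].
apply: (@wp_weaken _ _ _ (1 + (1 + ((15 * n + 4) + ((24 * n + 5) +
   (1 + (1 + (1 + (1 + (1 + (1 + B))))))))))); last first.
  rewrite /B; move: (lg n) lg0 => l l0; rewrite -mulnn.
  have h2 : n * n <= n * n * l by rewrite leq_pmulr.
  have h3 : n <= n * l by rewrite leq_pmulr.
  have -> : 400 * (n.+1 * n.+1) * l = 400 * (n * n * l) + 800 * (n * l) + 400 * l.
    by clear; nia.
  have -> : n * (114 * n + n * (17 * l) + 6 * l + 55) =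
    114 * (n * n) + 17 * (n * n * l) + 6 * (n * l) + 55 * n by clear; nia.
  by move: h2 h3 l0; move: (n * n * l) (n * n) (n * l) => x y z; clear; lia.
do 2 wstep.
have hc : consts n (setr (setr s 5 1) 28 0) by split; rewrite /= /upd.
apply: wp_seq; first exact: (width_progP hc).
move=> s1 [w1 w2] fs1; have [fr1 fa1] := fs1; have c1 := consts_same hc fs1 isT.
apply: wp_seq; first exact: (clear_progP c1).
move=> s2 [nn2 M2 M2n A2] fs2; have [fr2 fa2] := fs2; have c2 := consts_same c1 fs2 isT.
have [c20 c2o c2z] := c2.
have W2 : reg s2 rW = reg s1 rW by rewrite fr2.
set w := reg s1 rW in w1 w2 W2.
apply: (@wp_weaken _ _ _ (1 + (1 + (1 + (1 + (1 + (1 + (n * (row_cost n w + 5) + 1)))))))); last first.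
  do 6 (rewrite leq_add2l); rewrite /B leq_add2r leq_mul2l; apply/orP; right.
  rewrite /row_cost -addnA leq_add // leq_add //; last by rewrite leq_mul2l w2 orbT.
  by rewrite leq_add2l !leq_mul2l w2 !orbT.
do 6 wstep; rewrite /= /upd /= c20 c2z addn0.
set s3 := setr _ _ _.
have s3A : reg s3 rA = n by [].
rewrite -[n in n * (_ + 5)]s3A.
apply: wp_post; first apply: (@wp_loop R (fun k s' => inv n m w (n - k) s')).
- rewrite s3A subnn; split=> //=; rewrite /upd //=.
  + by rewrite /ones big_ord0.
  + move=> r k; rewrite leq_eqVlt => /orP[/eqP->|rn] kn; first by rewrite M2n // m0.
    rewrite M2 ?fa1 ?hM //.
    by have := leq_mul rn (leqnn n); rewrite mulSn; apply: leq_trans; rewrite addnC ltn_add2r.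
  + by move=> k kn; rewrite A2 // /acc big_ord0.
  + by exists [::]; split=> //; split.
- move=> k s'; rewrite s3A => kn hi _; rewrite -(subnSK kn).
  apply: row_progP => //; first by rewrite ltn_subrL (leq_trans _ kn).
  by case: hi => *; split.
by move=> s'; rewrite subn0 => -[].
Qed.

(** * The query programs *)

Definition exec_op (kd ks i : nat) : hcmd :=
  HLoad kd rX i;; HLoad ks rU i;; HLoad 6 rB i;; HSub rD rOne rB;;
  HLoop rB (HRAdd rX rX rU);; HLoop rD (HRSub rX rX rU).

Definition right_prog : hcmd :=
  HConst rOne 1;; HConst rZero 0;; HAdd rA rL rZero;;
  HLoop rA (HSub rT rL rA;; HSub rT rT rOne;; exec_op 2 3 rT).

Definition left_prog : hcmd :=
  HConst rOne 1;; HConst rZero 0;; HAdd rA rL rZero;; HLoop rA (exec_op 4 5 rA).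

Section Query.
Variable R : realType.
Implicit Types (s : hst R) (f : nat -> R).

Definition addto f (d s : nat) (b : bool) : nat -> R :=
  upd f d (if b then f d + f s else f d - f s)%R.

Definition run_right (ops : seq op) f : nat -> R :=
  foldl (fun f o => addto f (dR o) (sR o) (sg o)) f ops.
Definition run_left (ops : seq op) f : nat -> R :=
  foldr (fun o f => addto f (dL o) (sL o) (sg o)) f ops.

Lemma exec_opP kd ks i (b : bool) s : (i != rX) && (i != rU) ->
  reg s rOne = 1 -> arr s 6 (reg s i) = b ->
  wp (exec_op kd ks i)
    (fun s' => rm s' = addto (rm s) (arr s kd (reg s i)) (arr s ks (reg s i)) b) 33 s.
Proof.
move=> /andP[/negbTE iX /negbTE iU] h1 h6.
apply: (@wp_weaken _ _ _ (6 + (6 + (6 + (1 + ((1 + 6) + (1 + 6))))))) => //.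
do 4 wstep; rewrite /= /upd /= iX iU.
apply: wp_seq.
  apply: (@wp_if R b (fun s' => rm s' = if b then upd (rm s) (arr s kd (reg s i))
    (rm s (arr s kd (reg s i)) + rm s (arr s ks (reg s i)))%R else rm s)).
  - by rewrite /= /upd /= ?iX ?iU h6.
  - by move=> ->; split=> //=; rewrite /upd /= ?iX.
  - by move=> /negbTE->.
move=> s1 e1 [fr _].
have rX1 : reg s1 15 = arr s kd (reg s i) by rewrite fr //= /upd /=.
have rU1 : reg s1 25 = arr s ks (reg s i) by rewrite fr //= /upd /= ?iX.
apply: (@wp_if R (~~ b)).
- by rewrite fr //= /upd /= ?iX ?iU h6 h1; case: b {e1 h6}.
- by move=> nb; split=> //=; rewrite /upd /= rX1 rU1 e1 /addto /= (negbTE nb).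
- by rewrite negbK /addto e1 => ->.
Qed.

Lemma right_progP s ops : holds_tape s ops ->
  wp right_prog (fun s' => rm s' = run_right ops (rm s)) (40 * size ops + 4) s.
Proof.
move=> [hL hT].
pose I k s' := rm s' = run_right (take (size ops - k) ops) (rm s).
apply: wp_weaken.
  do 3 wstep; apply: wp_post; first (apply: (@wp_loop R I 35)).
  - by rewrite /I /= /upd /= hL addn0 subnn take0.
  - move=> k s'; rewrite [reg _ rA]/= /upd [X in X -> _]/= hL addn0 => kn i1 [fr fa].
    have r5 : reg s' 5 = 1 by rewrite fr.
    have r24 : reg s' 24 = size ops by rewrite fr.
    have a' x : arr s' x = arr s x by rewrite fa.
    have lt : size ops - k.+1 < size ops by rewrite ltn_subrL (leq_trans _ kn).
    have [a2 a3 _ _ a6] := hT _ lt.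
    apply: (@wp_weaken _ _ _ (1 + (1 + 33))) => //; do 2 wstep.
    have iE : size ops - k - 1 = size ops - k.+1 by rewrite -subnDA addn1.
    apply: wp_post; first apply: (@exec_opP 2 3 rT (sg (nth op0 ops (size ops - k.+1)))) => //.
    + by rewrite /= /upd /= r24 r5 iE a'.
    move=> s2; rewrite /= /upd /= r24 r5 iE !a' a2 a3 i1 => e _.
    rewrite /I e -(subnSK kn) (take_nth op0) // /run_right.
    by rewrite foldl_rcons.
  by move=> s'; rewrite /I subn0 take_size.
by rewrite /= /upd /= hL addn0; clear; lia.
Qed.

Lemma left_progP s ops : holds_tape s ops ->
  wp left_prog (fun s' => rm s' = run_left ops (rm s)) (40 * size ops + 4) s.
Proof.
move=> [hL hT].
pose I k s' := rm s' = run_left (drop k ops) (rm s).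
apply: wp_weaken.
  do 3 wstep; apply: wp_post; first (apply: (@wp_loop R I 33)).
  - by rewrite /I /= /upd /= hL addn0 drop_size.
  - move=> k s'; rewrite [reg _ rA]/= /upd [X in X -> _]/= hL addn0 => kn i1 [fr fa].
    have r5 : reg s' 5 = 1 by rewrite fr.
    have a' x : arr s' x = arr s x by rewrite fa.
    have [_ _ a4 a5 a6] := hT _ kn.
    apply: wp_post; first apply: (@exec_opP 4 5 rA (sg (nth op0 ops k))) => //.
    + by rewrite /= /upd /= a'.
    move=> s2; rewrite /= /upd /= !a' a4 a5 i1 => e _.
    by rewrite /I e (drop_nth op0 kn).
  by move=> s'; rewrite /I drop0.
by rewrite /= /upd /= hL addn0; clear; lia.
Qed.

Variables (n : nat) (m : nat -> nat -> bool).
Hypothesis m_n : forall k, m n k = false.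
Notation bit b := ((b : bool)%:R : R)%R.

Lemma run_right_diff i p (l : seq nat) f : all (fun k => k < n) l ->
  let g := run_right [seq Op (n + i) k (n + k) i (m i k) | k <- l & m i k != m p k] f in
  g (n + i) = (f (n + i) + \sum_(k <- l) (bit (m i k) - bit (m p k)) * f k)%R /\
  forall a, a != n + i -> g a = f a.
Proof.
elim: l f => [|k l IH] f /=; first by rewrite big_nil addr0.
move=> /andP[kn hl]; rewrite big_cons; case: ifP => [ne|/negbFE/eqP->] /=; last first.
  by rewrite subrr mul0r add0r; apply: IH.
have [g1 g2] := IH (addto f (n + i) k (m i k)) hl; split; last first.
  by move=> a ha; rewrite g2 // /addto /upd (negbTE ha).
rewrite g1 {1}/addto /upd eqxx.
rewrite (eq_big_seq (fun k => (bit (m i k) - bit (m p k)) * f k)%R); last first.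
  move=> k' k'l; rewrite /addto /upd ltn_eqF //.
  by apply: leq_trans (allP hl _ k'l) _; rewrite leq_addr.
by rewrite addrA; congr (_ + _)%R; move: ne; case: (m i k); case: (m p k) => // _; rewrite /=; ring.
Qed.

Lemma all_rev_iota : all (fun k => k < n) (rev (iota 0 n)).
Proof. by apply/allP => k; rewrite mem_rev mem_iota. Qed.

Lemma run_rightP ps (v : nat -> R) f : tree n m ps -> size ps <= n ->
  (forall a, a < n -> f a = v a) -> (forall a, n <= a -> f a = 0%R) ->
  let g := run_right (tape_of n m ps) f in
  [/\ forall a, a < n -> g a = v a,
      forall r, r < size ps -> g (n + r) = (\sum_(0 <= k < n) bit (m r k) * v k)%R &
      forall r, size ps <= r -> g (n + r) = 0%R].
Proof.
move=> + + fv f0; elim/last_ind: ps => [|ps p IH] tr.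
  by move=> _; split=> // r _; apply: f0 (leq_addr _ _).
rewrite size_rcons => psn; have {IH}[||g1 g2 g3] := IH.
- move=> i ips; have := tr i; rewrite size_rcons nth_rcons ips; apply; exact: ltnW.
- exact: ltnW.
have := tr (size ps); rewrite size_rcons ltnSn nth_rcons ltnn eqxx => /(_ isT) pok.
rewrite tape_of_rcons /run_right foldl_cat -/(run_right _ _) /=.
set g := run_right (tape_of n m ps) f in g1 g2 g3 *.
rewrite -/(run_right _ _) /diff_ops subn0.
set i := size ps in g2 g3 psn pok *.
have gp : g (n + p) = (\sum_(0 <= k < n) bit (m p k) * v k)%R.
  case: pok => [[_ ->]|[pi _]]; last exact: g2.
  by rewrite g3 ?(ltnW psn) // big1 // => k _; rewrite m_n mul0r.
have [h1 h2] := @run_right_diff i p (rev (iota 0 n)) (addto g (n + i) (n + p) true) all_rev_iota.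
split.
- move=> a an; rewrite h2 ?ltn_eqF ?(leq_trans an) ?leq_addr // /addto /upd.
  by rewrite ltn_eqF ?(leq_trans an) ?leq_addr // g1.
- move=> r; rewrite ltnS leq_eqVlt => /orP[/eqP->|ri].
    rewrite h1 {1}/addto /upd eqxx g3 // add0r gp.
    rewrite [X in (_ + X)%R](perm_big (iota 0 n)) /=; last by rewrite perm_rev.
    rewrite /index_iota subn0 -big_split /=; apply: eq_big_seq => k.
    rewrite mem_iota add0n => /andP[_ kn].
    rewrite /addto /upd ltn_eqF ?(leq_trans kn) ?leq_addr // g1 //.
    by ring.
  have ne : n + r != n + i by rewrite eqn_add2l ltn_eqF.
  by rewrite h2 // /addto /upd (negbTE ne) g2.
move=> r ir; have ne : n + r != n + i by rewrite eqn_add2l gtn_eqF.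
by rewrite h2 // /addto /upd (negbTE ne) g3 // ltnW.
Qed.

Lemma run_left_diff i p (l : seq nat) f : i < n -> all (fun k => k < n) l -> uniq l ->
  let g := run_left [seq Op (n + i) k (n + k) i (m i k) | k <- l & m i k != m p k] f in
  (forall c, c < n -> g (n + c) =
     (f (n + c) + (if c \in l then (bit (m i c) - bit (m p c)) * f i else 0))%R) /\
  forall a, a < n -> g a = f a.
Proof.
move=> i_n; elim: l => [|k l IH] /=; first by split=> // c _; rewrite addr0.
move=> /andP[kn hl] /andP[kl ul]; have [g1 g2] := IH hl ul.
set g := run_left _ f in g1 g2; split=> [c cn|a an]; last first.
  case: ifP => _; last exact: g2.
  by rewrite /= -/(run_left _ _) -/g /addto /upd (ltn_eqF (leq_trans an (leq_addr k n))) g2.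
rewrite inE; case: (c =P k) => [->|ck] /=; last first.
  case: ifP => _; last exact: g1.
  by rewrite /= -/(run_left _ _) -/g /addto /upd eqn_add2l (introF eqP ck) g1.
case: (boolP (m i k != m p k)) => [ne|/negPn/eqP e]; rewrite /= -/(run_left _ _) -/g.
  rewrite /addto /upd eqxx (g1 k) // (negbTE kl) addr0 g2 //.
  by move: ne; case: (m i k); case: (m p k) => // _; rewrite /=; ring.
by rewrite (g1 k) // (negbTE kl) e subrr mul0r.
Qed.

Lemma run_leftP ps f : tree n m ps -> size ps <= n -> forall c, c < n ->
  run_left (tape_of n m ps) f (n + c) =
  (f (n + c) + \sum_(0 <= r < size ps) f r * bit (m r c))%R.
Proof.
elim/last_ind: ps f => [|ps p IH] f tr; first by move=> _ c _; rewrite big_geq // addr0.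
rewrite size_rcons => psn c cn.
have := tr (size ps); rewrite size_rcons ltnSn nth_rcons ltnn eqxx => /(_ isT) pok.
rewrite tape_of_rcons /run_left foldr_cat -/(run_left _ _) IH //; last first.
- exact: ltnW.
- move=> i ips; have := tr i; rewrite size_rcons nth_rcons ips; apply; exact: ltnW.
set i := size ps in psn pok *; rewrite /= -/(run_left _ _) /diff_ops subn0.
have [g1 g2] := @run_left_diff i p (rev (iota 0 n)) f psn all_rev_iota
  (eq_ind_r _ (iota_uniq 0 n) (rev_uniq (iota 0 n))).
set g := run_left _ f in g1 g2 *.
rewrite big_nat_recr //=.
have gc : g (n + c) = (f (n + c) + (bit (m i c) - bit (m p c)) * f i)%R.
  by rewrite g1 // mem_rev mem_iota cn.
case: pok => [[i0 pn]|[pi _]]; rewrite /lcell.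
  have b0 (F : nat -> R) : (\sum_(0 <= r < i) F r = 0)%R by rewrite i0 big_geq.
  rewrite pn eqxx !b0 /addto /upd eqn_add2l ltn_eqF // gc pn m_n /=.
  by ring.
rewrite (ltn_eqF (ltn_trans pi psn)) /addto {1}/upd gtn_eqF ?gc; last first.
  by apply: leq_trans (ltn_trans pi psn) _; rewrite leq_addr.
have -> : (\sum_(0 <= r < i) upd g p (g p + g i) r * bit (m r c) =
   \sum_(0 <= r < i) f r * bit (m r c) + f i * bit (m p c))%R.
  have -> : (f i * bit (m p c) = \sum_(0 <= r < i) if r == p then f i * bit (m r c) else 0)%R.
    by rewrite -big_mkcond /= big_nat1_eq pi.
  rewrite -big_split /=; apply: eq_big_nat => r /andP[_ ri].
  rewrite /upd; case: eqP => [->|_]; last by rewrite g2 ?addr0 // (ltn_trans ri).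
  by rewrite !g2 ?(ltn_trans pi) // mulrDl.
by ring.
Qed.

Lemma size_tape ps : size (tape_of n m ps) =
  \sum_(i < size ps) (ham n m i (nth 0 ps i)).+1.
Proof.
elim/last_ind: ps => [|ps p IH]; first by rewrite big_ord0.
rewrite tape_of_rcons size_cat IH size_rcons big_ord_recr /= nth_rcons ltnn eqxx.
congr (_ + _.+1).
  by apply: eq_bigr => i _; rewrite nth_rcons ltn_ord.
rewrite size_map size_filter count_rev subn0 /ham -sum1_count big_mkcond /=.
rewrite -[in RHS](big_mkord xpredT (fun k => (m (size ps) k != m p k) : nat)) /index_iota subn0.
by apply: eq_bigr => k _; case: (_ != _).
Qed.

End Query.

Definition nat_entry n (M : 'M[bool]_n) (r k : nat) : bool :=
  if insub r is Some i then if insub k is Some j then M i j else false else false.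

Lemma nat_entryE n (M : 'M[bool]_n) (i j : 'I_n) : nat_entry M i j = M i j.
Proof. by rewrite /nat_entry !valK. Qed.

Lemma nat_entry_n n (M : 'M[bool]_n) k : nat_entry M n k = false.
Proof. by rewrite /nat_entry insubF // ltnn. Qed.

Lemma ham_hamming n (M : 'M[bool]_n) (i j : 'I_n) :
  ham n (nat_entry M) i j = hamming M i j.
Proof. by apply: eq_bigr => c _; rewrite !nat_entryE. Qed.

Lemma input_bit (R : realType) n (M : 'M[bool]_n) a :
  nmem (input_cfg R M) a.+1 <= 1.
Proof. by rewrite /=; case: insub => // i; case: insub => // j; case: (M i j). Qed.

Lemma input_entry (R : realType) n (M : 'M[bool]_n) r k : r < n -> k < n ->
  nmem (input_cfg R M) (r * n + k).+1 = nat_entry M r k.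
Proof.
move=> rn kn; have n0 : 0 < n by apply: leq_ltn_trans rn.
rewrite /= divnMDl // divn_small // addn0 modnMDl modn_small // /nat_entry.
by case: insub => // i; case: insub.
Qed.

Lemma tape_bound n (M : 'M[bool]_n) d ps : twin_width_le M d -> size ps = n ->
  tree n (nat_entry M) ps ->
  size (tape_of n (nat_entry M) ps) <= (d * 2 ^ d * 8 + 5) * n * lg n ^ 2.
Proof.
move=> Md psn tr; rewrite size_tape.
have -> : \sum_(i < size ps) (ham n (nat_entry M) i (nth 0 ps i)).+1 =
   n + \sum_(i < n) ham n (nat_entry M) i (nth 0 ps i).
  rewrite psn (eq_bigr (fun i : 'I_n => 1 + ham n (nat_entry M) i (nth 0 ps i))) //.
  by rewrite big_split /= sum1_card card_ord.
have := @sum_greedy_distances n M d (fun i => ham n (nat_entry M) i (nth 0 ps i)) Md.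
have lg0 : 0 < lg n ^ 2 by rewrite expn_gt0.
move=> /(_ (fun i => ham_le _ _ _ _)) h.
rewrite addnS mulSn mulnDl leq_add ?leq_pmulr //; apply: h => i j ji; rewrite -ham_hamming.
have := tr i; rewrite psn => /(_ (ltn_ord i)) [[i0 _]|[_]]; first by rewrite i0 in ji.
exact.
Qed.

Lemma preprocessing_time_le n l K : 0 < l ->
  22 * (n * n) + 7 * n + 130 + 400 * n.+1 ^ 2 * l <= (600 + K) * n.+1 ^ 2 * l ^ 2.
Proof.
move=> l0; have h1 : n.+1 ^ 2 * l <= n.+1 ^ 2 * l ^ 2.
  by rewrite leq_mul2l -mulnn leq_pmulr ?orbT.
have h2 : n.+1 ^ 2 <= n.+1 ^ 2 * l ^ 2 by rewrite leq_pmulr ?expn_gt0 ?l0.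
have h3 : 22 * (n * n) + 7 * n + 130 <= 130 * n.+1 ^ 2 by rewrite -mulnn; clear; nia.
have -> : 400 * n.+1 ^ 2 * l = 400 * (n.+1 ^ 2 * l) by rewrite mulnA.
have -> : (600 + K) * n.+1 ^ 2 * l ^ 2 =
  600 * (n.+1 ^ 2 * l ^ 2) + K * (n.+1 ^ 2 * l ^ 2) by rewrite -mulnDl mulnA.
move: (n.+1 ^ 2 * l) (n.+1 ^ 2 * l ^ 2) (n.+1 ^ 2) h1 h2 h3 => x y q h1 h2 h3.
by move: (K * y) (22 * (n * n) + _ + _) h3 => u z h3; clear -h1 h2 h3; lia.
Qed.

Lemma query_time_le n l K o : 0 < l -> o <= K * n * l ->
  40 * o + 4 <= (600 + 40 * K) * n.+1 * l.
Proof.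
move=> l0 oK; apply: leq_trans (_ : 40 * (K * n * l) + 4 * l <= _).
  by apply: leq_add; [rewrite leq_mul2l oK|rewrite leq_pmulr].
have -> : (600 + 40 * K) * n.+1 * l =
  40 * (K * n * l) + (40 * (K * l) + (600 * (n * l) + 600 * l)).
  by clear; lia.
by move: (K * n * l) (n * l) (K * l) => x y z; clear; lia.
Qed.

Lemma sim_setrm (R : realType) (s : memory R) (h : hst R) (f : nat -> R) :
  sim s h -> sim (s.1, f) (Hst (reg h) (arr h) f).
Proof. by case=> h1 h2 _. Qed.

Definition view (R : realType) (s : memory R) : hst R :=
  Hst s.1 (fun k i => s.1 (cell k i)) s.2.

Local Open Scope ring_scope.

(* One uniform algorithm (preprocessing program P, query programs Qr for
   M v and Ql for v^T M) with running times f(d) n^2 log^c n and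
   f(d) n log^c n on the unit-cost RAM of Defs.v. Outputs are read from
   real cells n .. 2n-1. *)
Theorem theorem2 :
  exists (P Qr Ql : program) (f : nat -> nat) (c : nat),
    forall (R : realType) (n d : nat) (M : 'M[bool]_n),
      twin_width M d ->
      exists S : cfg R,
        halts_within P (input_cfg R M) (f d * n.+1 ^ 2 * lg n ^ c)%N S /\
        forall v : 'cV[R]_n,
          (exists S' : cfg R,
              halts_within Qr (query_cfg S v) (f d * n.+1 * lg n ^ c)%N S' /\
              forall i : 'I_n, rmem S' (n + i)%N = (real_mx R M *m v) i 0) /\
          (exists S' : cfg R,
              halts_within Ql (query_cfg S v) (f d * n.+1 * lg n ^ c)%N S' /\
              forall j : 'I_n, rmem S' (n + j)%N = (v^T *m real_mx R M) 0 j).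
Proof.
exists (compile 0 (LSeq relocate (tr main_prog))), (compile 0 (tr right_prog)),
  (compile 0 (tr left_prog)), (fun d => 600 + 40 * (d * 2 ^ d * 8 + 5))%N, 2%N.
move=> R n d M [Md _].
set K := (d * 2 ^ d * 8 + 5)%N; set m := nat_entry M.
have lg0 : (0 < lg n)%N by [].
have [t1 [s1 [ev1 t1T s1R s10 s1M]]] :=
  @relocateP R _ (@input_bit R n M) n (fun=> 0) (erefl : nmem (input_cfg R M) 0 = n).
have sim1 : sim s1 (view s1) by [].
have [||[ps [psn ps_tree hT]] c2] := @main_progP R n m (view s1) s10.
- move=> r k rn kn; rewrite /= s1M ?input_entry //.
  by have := leq_mul rn (leqnn n); rewrite mulSn; apply: leq_trans; rewrite addnC ltn_add2r.
- exact: nat_entry_n.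
have [s2 ev2 sim2] := sim_ev (isT : wf main_prog) sim1.
have s2R : s2.2 = fun=> 0.
  by case: sim2 => _ _ ->; rewrite frame_rm // s1R.
move: (den main_prog (view s1)) hT sim2 => h hT sim2.
exists (Cfg (lsize (LSeq relocate (tr main_prog))) s2.1 s2.2); split.
  apply: (ev_halts (s := ((input_cfg R M).(nmem), fun=> 0)) (ev_seq ev1 ev2)).
  apply: leq_trans (leq_add t1T c2) _.
  exact: preprocessing_time_le.
move=> v; set ops := tape_of n m ps in hT.
have qT : (40 * size ops + 4 <= (600 + 40 * K) * n.+1 * lg n ^ 2)%N.
  have := tape_bound Md psn ps_tree; rewrite -/K -/m -/ops.
  have : (0 < lg n ^ 2)%N by rewrite expn_gt0.
  exact: query_time_le.
set f0 : nat -> R := fun a => if insub a is Some i then v i 0 else s2.2 a.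
have fv (i : 'I_n) : f0 i = v i 0 by rewrite /f0 valK.
have f00 a : (n <= a)%N -> f0 a = 0 by move=> na; rewrite /f0 insubF ?s2R // ltnNge na.
have sim3 := sim_setrm f0 sim2.
have hT3 : holds_tape (Hst (reg h) (arr h) f0) ops by [].
split.
- have [s3 ev3 [_ _ s3R]] := sim_ev (isT : wf right_prog) sim3.
  have [r3 c3] := right_progP hT3.
  exists (Cfg (lsize (tr right_prog)) s3.1 s3.2); split.
    exact: (ev_halts (s := (s2.1, f0)) ev3 (leq_trans c3 qT)).
  move=> i; rewrite /= s3R r3 /=.
  have psn' : (size ps <= n)%N by rewrite psn.
  have [_ run _] := @run_rightP R n m (@nat_entry_n n M) ps f0 f0 ps_tree psn' (fun _ _ => erefl) f00.
  rewrite run ?psn //.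
  rewrite mxE big_mkord; apply: eq_bigr => k _.
  by rewrite !mxE fv /m nat_entryE.
- have [s3 ev3 [_ _ s3R]] := sim_ev (isT : wf left_prog) sim3.
  have [r3 c3] := left_progP hT3.
  exists (Cfg (lsize (tr left_prog)) s3.1 s3.2); split.
    exact: (ev_halts (s := (s2.1, f0)) ev3 (leq_trans c3 qT)).
  move=> j; rewrite /= s3R r3 /= run_leftP ?psn //; last exact: nat_entry_n.
  rewrite f00 ?leq_addr // add0r mxE big_mkord; apply: eq_bigr => k _.
  by rewrite !mxE fv /m nat_entryE.
Qed.
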